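(* Let $C\geq 0$ and let $(e_k)$ be an orthonormal sequence (finite or infinite) in $L^2(\mathbb{R})$ such that $\Delta(e_k)\leq C$, $\Delta(\widehat{e_k})\leq C$, $|\mu(e_k)|\leq C$ and $|\mu(\widehat{e_k})|\leq C$ for all $k$. Then the sequence has at most $8\pi C^2$ elements.
   Context: The Fourier transform is $\widehat{f}(\xi)=\int_{\mathbb{R}} f(x)e^{-2i\pi x\xi}\,dx$ for $f\in L^1(\mathbb{R})\cap L^2(\mathbb{R})$, extended to $L^2(\mathbb{R})$ as usual. For nonzero $f\in L^2(\mathbb{R})$, the mean is $\mu(f)=\frac{1}{\|f\|_2^2}\int_{\mathbb{R}} t|f(t)|^2\,dt$, the variance is $\Delta^2(f)=\int_{\mathbb{R}} |t-\mu(f)|^2|f(t)|^2\,dt$, and the dispersion is $\Delta(f)=\sqrt{\Delta^2(f)}$. Convention: if $\int_{\mathbb{R}} t^2|f(t)|^2\,dt=+\infty$, then $\Delta(f)=+\infty$. *)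

(* Defs.v *)
From HB Require Import structures.
From mathcomp Require Import all_boot all_order all_algebra.
From mathcomp Require Export complex.
From mathcomp Require Export all_classical all_reals all_analysis.
Set Implicit Arguments.
Unset Strict Implicit.
Unset Printing Implicit Defensive.
Import Order.TTheory GRing.Theory Num.Theory.
Import numFieldNormedType.Exports.

Local Open Scope classical_set_scope.
Local Open Scope ring_scope.
Local Open Scope complex_scope.

(* Elements of L^p(R) are represented by Borel functions from R to R[i];
   every notion below depends only on their almost-everywhere class. *)

Definition modulus (R : realType) (z : R[i]) : R := ComplexField.Normc.normc z.

(* Complex integral, computed on real and imaginary parts; meaningful
   when both are integrable. *)
Definition Cintegral (R : realType) (f : R -> R[i]) : R[i] :=
  (\int[@lebesgue_measure R]_x complex.Re (f x)) +i*
  (\int[@lebesgue_measure R]_x complex.Im (f x)).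

Definition inLp (R : realType) (p : \bar R) (f : R -> R[i]) : Prop :=
  ((fun x => complex.Re (f x)) \in Lfun (@lebesgue_measure R) p) /\
  ((fun x => complex.Im (f x)) \in Lfun (@lebesgue_measure R) p).

Definition L2norm (R : realType) (f : R -> R[i]) : \bar R :=
  Lnorm (@lebesgue_measure R) 2%:E (fun x => (modulus (f x))%:E).

Definition L2inner (R : realType) (f g : R -> R[i]) : R[i] :=
  Cintegral (fun x => f x * (g x)^*).

Definition L2cvg (R : realType) (f_ : nat -> R -> R[i]) (f : R -> R[i]) : Prop :=
  L2norm (fun x => f_ n x - f x) @[n --> \oo] --> 0%E.

Definition expi (R : realType) (t : R) : R[i] := cos t +i* sin t.

Definition fourierL1 (R : realType) (f : R -> R[i]) (xi : R) : R[i] :=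
  Cintegral (fun x => f x * expi (- (2 * pi * x * xi))).

(* [g] represents the Fourier transform of [f] in L^2: the graph of the
   extension of [fourierL1] by continuity from L^1 `&` L^2 to L^2.  A relation
   is used because [g] is only determined almost everywhere. *)
Definition is_fourier (R : realType) (f g : R -> R[i]) : Prop :=
  [/\ inLp 2%:E f, inLp 2%:E g &
    exists f_ : nat -> R -> R[i],
      [/\ forall n, inLp 1 (f_ n) /\ inLp 2%:E (f_ n),
          L2cvg f_ f & L2cvg (fun n => fourierL1 (f_ n)) g]].

Definition mean (R : realType) (f : R -> R[i]) : R :=
  (fine (L2norm f) ^+ 2)^-1 *
  \int[@lebesgue_measure R]_t (t * modulus (f t) ^+ 2).

(* When the second moment is infinite the mean need not exist, whence the
   explicit convention. *)
Definition fun_variance (R : realType) (f : R -> R[i]) : \bar R :=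
  if (\int[@lebesgue_measure R]_t (t ^+ 2 * modulus (f t) ^+ 2)%:E)%E == +oo%E
  then +oo%E
  else (\int[@lebesgue_measure R]_t
          (`|t - mean f| ^+ 2 * modulus (f t) ^+ 2)%:E)%E.

Definition dispersion (R : realType) (f : R -> R[i]) : \bar R :=
  sqrte (fun_variance f).

(* Index set of a sequence: [Some n] for n terms e_0, ..., e_(n-1), [None] for
   an infinite sequence. *)
Definition indices (N : option nat) : set nat :=
  if N is Some n then [set k | (k < n)%N] else setT.

Definition orthonormal_seq (R : realType) (N : option nat)
    (e : nat -> R -> R[i]) : Prop :=
  (forall k, indices N k -> inLp 2%:E (e k)) /\
  (forall j k, indices N j -> indices N k ->
     L2inner (e j) (e k) = (j == k)%:R).

(* Main.v *)
Require Import Defs.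
From HB Require Import structures.
From mathcomp Require Import all_boot all_order all_algebra.
From mathcomp Require Import complex all_classical all_reals all_analysis.
From mathcomp Require Import measurable_realfun ring lra.
Set Implicit Arguments.
Unset Strict Implicit.
Unset Printing Implicit Defensive.
Import Order.TTheory GRing.Theory Num.Theory.
Import numFieldNormedType.Exports.
Local Open Scope classical_set_scope.
Local Open Scope ring_scope.
Local Open Scope complex_scope.

(** The harmonic oscillator [x^2 + xi^2] has eigenvalues [(2j + 1) / (2 pi)] on the
    Hermite functions, so [n] orthonormal functions have total second moments (in
    time and frequency) at least [1/(2 pi) + 3/(2 pi) + ... = n^2 / (2 pi)], while the
    hypotheses bound this total by [4 C^2 n].

    Let [a_j] be the Hermite coefficients of [f].  Those of its transform are
    [(- i)^j a_j], by Fubini and passage to the limit; completeness of the Hermite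
    functions then gives Plancherel.  Multiplication by [x] is a Jacobi matrix in the
    Hermite basis, so by Bessel and the parallelogram identity the two second moments
    together dominate [sum_j (2j + 1) |a_j|^2 / (2 pi)].  Summing over [n] orthonormal
    functions, each [j] has total weight at most [1] and all weights add up to [n]; the
    sum is least when the weights fill [j < n].

    Completeness of the Hermite functions is proved in a weak form: if [r_n] is bounded
    in [L^2] and asymptotically orthogonal to every polynomial times
    [g = exp (- pi x^2)], then to every [u] in [L^2].  The bounded [phi] for which [p g phi] is
    such a [u] for all polynomials [p] are closed under multiplication by
    [exp (- (x - c)^2 / 2)] (Taylor expansion and dominated convergence), hence contain the
    polynomials in a smooth function [s] with [s < 1/2] exactly for [x < c]; these approximate
    the indicator of [x < c], and a monotone class argument concludes. *)

(** * Square-integrable functions *)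

Local Notation "mu .-intg u" := (mu.-integrable setT (EFin \o u))
  (at level 2, u at level 9, format "mu .-intg  u").

Section SquareIntegrable.
Context d (T : measurableType d) (R : realType) (mu : {measure set T -> \bar R}).
Implicit Types (u v w : T -> R) (k : R).

Lemma intg_measurable u : mu.-intg u -> measurable_fun setT u.
Proof. by move/integrableP => [/measurable_EFinP]. Qed.

Lemma intgD u v : mu.-intg u -> mu.-intg v -> mu.-intg (fun x => u x + v x).
Proof. by move=> hu hv; apply: eq_integrable (integrableD _ hu hv). Qed.

Lemma intgZ k u : mu.-intg u -> mu.-intg (fun x => k * u x).
Proof. by move=> hu; apply: eq_integrable (integrableZl _ k hu). Qed.

Lemma intgB u v : mu.-intg u -> mu.-intg v -> mu.-intg (fun x => u x - v x).
Proof. by move=> hu hv; apply: eq_integrable (integrableB _ hu hv). Qed.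

Lemma intg_eq u v : u =1 v -> mu.-intg u -> mu.-intg v.
Proof. by move=> /funext ->. Qed.

Lemma intg_le u v : measurable_fun setT u -> (forall x, `|u x| <= v x) ->
  mu.-intg v -> mu.-intg u.
Proof.
move=> mu_ uv iv; apply: le_integrable iv => //.
  exact/measurable_EFinP.
by move=> x _ /=; rewrite lee_fin (le_trans (uv x))// ler_norm.
Qed.

Definition sqint u := measurable_fun setT u /\ mu.-intg (fun x => u x ^+ 2).

(** Defined for all [u] and [v]; the algebraic rules need integrable products, which [sqint_mul]
    provides for square-integrable factors. Complex functions enter only through their real and
    imaginary parts. *)
Definition dot u v := \int[mu]_x (u x * v x).

Lemma sqint_eq u v : u =1 v -> sqint u -> sqint v.
Proof. by move=> /funext ->. Qed.

(** The squares of [u + v] and [u - v] are nonnegative, whence [|u v| <= u^2 + v^2]. *)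
Lemma sqint_mul u v : sqint u -> sqint v -> mu.-intg (fun x => u x * v x).
Proof.
move=> [mu_ iu] [mv iv]; apply: intg_le (intgD iu iv).
  exact: measurable_funM.
move=> x; rewrite ler_norml.
by apply/andP; split; [have := sqr_ge0 (u x + v x)|have := sqr_ge0 (u x - v x)];
  have := sqr_ge0 (u x); have := sqr_ge0 (v x); nra.
Qed.

Lemma sqint_le u v : measurable_fun setT u -> (forall x, `|u x| <= v x) ->
  sqint v -> sqint u.
Proof.
move=> mu_ uv [mv iv]; split => //.
apply: intg_le iv; first exact: measurable_funX.
move=> x; rewrite ger0_norm ?sqr_ge0// -(real_normK (num_real (u x))).
by rewrite lerXn2r ?nnegrE// (le_trans _ (uv x)).
Qed.

Lemma sqintD u v : sqint u -> sqint v -> sqint (fun x => u x + v x).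
Proof.
move=> hu hv; have := sqint_mul hu hv; case: hu hv => mu_ iu [mv iv] iuv.
split; first exact: measurable_funD.
apply: intg_eq (intgD (intgD iu iv) (intgZ 2 iuv)) => x; ring.
Qed.

Lemma sqintZ k u : sqint u -> sqint (fun x => k * u x).
Proof.
move=> [mu_ iu]; split; first exact: measurable_funM.
by apply: intg_eq (intgZ (k ^+ 2) iu) => x; ring.
Qed.

Lemma sqintB u v : sqint u -> sqint v -> sqint (fun x => u x - v x).
Proof.
move=> hu /(sqintZ (-1)) hv; apply: sqint_eq (sqintD hu hv) => x; ring.
Qed.

Lemma sqint_sum n (u : nat -> T -> R) : (forall i, (i < n)%N -> sqint (u i)) ->
  sqint (fun x => \sum_(i < n) u i x).
Proof.
elim: n => [|n IH] h.
  apply: (@sqint_eq (cst 0)); first by move=> x; rewrite big_ord0.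
  split; first exact: measurable_cst.
  by apply: eq_integrable (integrable0 _ _) => // x _ /=; rewrite expr0n.
apply: (@sqint_eq (fun x => \sum_(i < n) u i x + u n x)).
  by move=> x; rewrite big_ord_recr.
by apply: sqintD; [apply: IH => i ni; apply: h; exact: leqW|exact: h].
Qed.

Lemma sqint_norm u : sqint u -> sqint (fun x => `|u x|).
Proof.
move=> [mu_ iu]; split; first exact: measurableT_comp.
by apply: intg_eq iu => x; rewrite real_normK// num_real.
Qed.

Lemma eq_dot u v u' v' : u =1 u' -> v =1 v' -> dot u v = dot u' v'.
Proof. by move=> /funext -> /funext ->. Qed.

Lemma dotC u v : dot u v = dot v u.
Proof. by apply: eq_Rintegral => x _; rewrite mulrC. Qed.

Lemma dotDl u v w : sqint u -> sqint v -> sqint w ->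
  dot (fun x => u x + v x) w = dot u w + dot v w.
Proof.
move=> hu hv hw; rewrite /dot -RintegralD//; [|exact: sqint_mul|exact: sqint_mul].
by apply: eq_Rintegral => x _; rewrite mulrDl.
Qed.

Lemma dotZl k u w : sqint u -> sqint w ->
  dot (fun x => k * u x) w = k * dot u w.
Proof.
move=> hu hw; rewrite /dot -RintegralZl//; last exact: sqint_mul.
by apply: eq_Rintegral => x _; rewrite mulrA.
Qed.

Lemma dotBl u v w : sqint u -> sqint v -> sqint w ->
  dot (fun x => u x - v x) w = dot u w - dot v w.
Proof.
move=> hu hv hw; rewrite /dot -RintegralB//; [|exact: sqint_mul|exact: sqint_mul].
by apply: eq_Rintegral => x _; rewrite mulrBl.
Qed.

Lemma dot_suml n (u : nat -> T -> R) w : (forall i, (i < n)%N -> sqint (u i)) -> sqint w ->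
  dot (fun x => \sum_(i < n) u i x) w = \sum_(i < n) dot (u i) w.
Proof.
move=> + hw; elim: n => [|n IH] h.
  rewrite big_ord0 /dot -(@Rintegral_set0 _ _ _ mu (cst 0)) /Rintegral integral_set0.
  by rewrite integral0_eq// => x _; rewrite big_ord0 mul0r.
rewrite big_ord_recr/= -IH; last by move=> i ni; apply: h; exact: leqW.
rewrite -dotDl//; last first.
- exact: h.
- by apply: sqint_sum => i ni; apply: h; exact: leqW.
by apply: eq_dot => // x; rewrite big_ord_recr.
Qed.

Lemma dot_ge0 u : 0 <= dot u u.
Proof. by apply: Rintegral_ge0 => x _; rewrite -expr2 sqr_ge0. Qed.

Lemma dotDr u v w : sqint u -> sqint v -> sqint w ->
  dot w (fun x => u x + v x) = dot w u + dot w v.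
Proof. by move=> *; rewrite dotC dotDl// !(dotC w). Qed.

Lemma dotBr u v w : sqint u -> sqint v -> sqint w ->
  dot w (fun x => u x - v x) = dot w u - dot w v.
Proof. by move=> *; rewrite dotC dotBl// !(dotC w). Qed.

Lemma dotZr k u w : sqint u -> sqint w ->
  dot w (fun x => k * u x) = k * dot w u.
Proof. by move=> *; rewrite dotC dotZl// (dotC w). Qed.

Lemma dot_sumr n (u : nat -> T -> R) w : (forall i, (i < n)%N -> sqint (u i)) -> sqint w ->
  dot w (fun x => \sum_(i < n) u i x) = \sum_(i < n) dot w (u i).
Proof. by move=> *; rewrite dotC dot_suml//; apply: eq_bigr => i _; rewrite dotC. Qed.

Lemma cauchy_schwarz u v : sqint u -> sqint v ->
  dot u v ^+ 2 <= dot u u * dot v v.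
Proof.
move=> hu hv.
have key s t : 0 <= s ^+ 2 * dot u u + 2 * s * t * dot u v + t ^+ 2 * dot v v.
  have := dot_ge0 (fun x => s * u x + t * v x).
  have hsu := sqintZ s hu; have htv := sqintZ t hv.
  rewrite dotDl ?dotDr ?dotZl ?dotZr//; last exact: sqintD.
  rewrite (dotC v u) => h; apply: (le_trans h); rewrite le_eqVlt.
  by apply/orP; left; apply/eqP; ring.
have := dot_ge0 u; have := dot_ge0 v.
set a := dot u u in key *; set b := dot u v in key *; set c := dot v v in key *.
move=> c0 a0.
have [a00|a00] := eqVneq a 0; last first.
  have ap : 0 < a by rewrite lt_def a00.
  (* At [s = b], [t = - a] the quadratic form equals [a (a c - b^2)]. *)
  have := key b (- a).
  rewrite (_ : _ + _ = a * (a * c - b ^+ 2)); last by ring.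
  by rewrite pmulr_rge0// subr_ge0.
have [->|b0] := eqVneq b 0; first by rewrite a00 mul0r expr0n.
(* When [a = 0] the form is affine in [s]; this [s] would give it the value [- 1], so [b] has to
   vanish. *)
have := key (- (c + 1) / (2 * b)) 1; rewrite a00 mulr0 add0r expr1n mul1r mulr1.
by rewrite (_ : _ + _ = -1); [rewrite oppr_ge0 ler10|field; exact: b0].
Qed.

Lemma cvg_Rintegral (u : nat -> T -> R) v G :
  (forall n, measurable_fun setT (u n)) -> measurable_fun setT v ->
  {ae mu, forall x, u n x @[n --> \oo] --> v x} ->
  (forall n x, `|u n x| <= G x) -> mu.-intg G ->
  \int[mu]_x u n x @[n --> \oo] --> \int[mu]_x v x.
Proof.
move=> mu_ mv uv uG iG.
have [||||] := @dominated_convergence _ _ _ mu setT measurableT (fun n => EFin \o u n)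
  (EFin \o v) (EFin \o G) _ _ _ iG.
- by move=> n; exact/measurable_EFinP.
- exact/measurable_EFinP.
- apply: filterS uv => x h _; apply: cvg_EFin; first exact: nearW.
  exact: h.
- by apply: aeW => x n _ /=; rewrite lee_fin.
move=> iv _ h; apply: fine_cvg.
rewrite /Rintegral fineK//; exact: integrable_fin_num.
Qed.

Lemma cvg_dist_sqint (u : nat -> T -> R) v G :
  (forall n, measurable_fun setT (u n)) -> measurable_fun setT v ->
  {ae mu, forall x, u n x @[n --> \oo] --> v x} ->
  (forall n x, `|u n x| <= G x) -> (forall x, `|v x| <= G x) -> sqint G ->
  dot (fun x => u n x - v x) (fun x => u n x - v x) @[n --> \oo] --> 0.
Proof.
move=> mu_ mv uv uG vG [mG iG].
rewrite [X in _ --> X](_ : 0 = \int[mu]_x (cst 0 x)); last first.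
  by rewrite /Rintegral integral0_eq.
(* Both [u n] and [v] are bounded by [G], so the squared difference is at most [(2 G)^2]. *)
apply: (@cvg_Rintegral _ _ (fun x => 4 * G x ^+ 2)).
- by move=> n; apply: measurable_funM; exact: measurable_funB.
- exact: measurable_cst.
- apply: filterS uv => x h.
  rewrite (_ : cst 0 x = (v x - v x) * (v x - v x)); last by rewrite subrr mul0r.
  by apply: cvgM; apply: cvgB => //; exact: cvg_cst.
- move=> n x; rewrite -expr2 ger0_norm ?sqr_ge0//.
  by have := uG n x; have := vG x; rewrite !ler_norml => /andP[? ?] /andP[? ?]; nra.
- exact: intgZ.
Qed.

End SquareIntegrable.

(** * Gaussians *)

Section Gaussian.
Context {R : realType}.
Local Notation mu := (@lebesgue_measure R).
Implicit Types (p q : {poly R}) (l x : R).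

Definition gauss l x := expR (- (l * x ^+ 2)).

Lemma gauss_gt0 l x : 0 < gauss l x.
Proof. exact: expR_gt0. Qed.

Lemma gaussM l m x : gauss l x * gauss m x = gauss (l + m) x.
Proof. by rewrite /gauss -expRD mulrDl opprD. Qed.

Lemma gauss_sqr l x : gauss l x ^+ 2 = gauss (l *+ 2) x.
Proof. by rewrite expr2 gaussM -mulr2n. Qed.

Lemma is_derive_gauss l x : is_derive x 1 (gauss l) (- (2 * l * x) * gauss l x).
Proof.
rewrite (_ : gauss l = expR \o (fun y => (- l) * (y ^+ 2))); last first.
  by apply/funext => y; rewrite /gauss /= mulNr.
apply: is_derive_eq.
by rewrite /gauss !scaler1 /= /GRing.scale/= -mulNr; ring.
Qed.

Lemma continuous_is_derive (f df : R -> R) :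
  (forall x, is_derive x 1 f (df x)) -> continuous f.
Proof. by move=> h x; apply/differentiable_continuous/derivable1_diffP; case: (h x). Qed.

Lemma continuous_gauss l : continuous (gauss l).
Proof. exact: continuous_is_derive (is_derive_gauss l). Qed.

Lemma measurable_gauss l : measurable_fun setT (gauss l).
Proof. by apply: continuous_measurable_fun; exact: continuous_gauss. Qed.

Lemma measurable_horner p : measurable_fun setT (horner p).
Proof. by apply: continuous_measurable_fun; exact: continuous_horner. Qed.

(** Up to its peak value, [gauss l] is the centred normal density of variance [1 / (2 l)]. *)
Lemma intg_gauss l : 0 < l -> mu.-intg (gauss l).
Proof.
move=> l0; pose s := Num.sqrt ((l *+ 2)^-1).
have l20 : 0 < (l *+ 2)^-1 by rewrite invr_gt0 mulrn_wgt0.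
have s0 : s != 0 by rewrite gt_eqF// sqrtr_gt0.
have := intgZ (normal_peak s)^-1 (integrable_normal_pdf 0 s).
apply: intg_eq => x; rewrite normal_pdfE// mulKf ?gt_eqF ?normal_peak_gt0//.
rewrite /normal_fun /gauss subr0 sqr_sqrtr ?ltW//; congr expR.
by field; rewrite gt_eqF.
Qed.

(** Induction on [p]: half of the exponent pays for the smaller polynomial, the other half for one
    factor [x], through [|x| <= (1 + x^2) / 2] and [1 + y <= exp y]. *)
Lemma horner_le_gauss l p : 0 < l ->
  exists2 K, 0 <= K & forall x, `|p.[x]| <= K * expR (l * x ^+ 2).
Proof.
elim/poly_ind: p l => [|p c IH] l l0.
  by exists 0 => // x; rewrite horner0 normr0 mul0r.
have [K K0 hK] := IH (l / 2) (divr_gt0 l0 (ltr0n _ 2)).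
exists (K * (1 + l^-1) + `|c|) => [|x].
  by rewrite addr_ge0// mulr_ge0// addr_ge0// invr_ge0 ltW.
rewrite hornerMXaddC (le_trans (ler_normD _ _))// mulrDl lerD//; last first.
  by rewrite ler_peMr// -expR0 ler_expR mulr_ge0 ?sqr_ge0// ltW.
rewrite normrM (_ : l * _ = l / 2 * x ^+ 2 + l / 2 * x ^+ 2); last by field.
suff hx : `|x| <= (1 + l^-1) * expR (l / 2 * x ^+ 2).
  rewrite (le_trans (ler_pM _ _ (hK x) hx))// expRD le_eqVlt.
  by apply/orP; left; apply/eqP; ring.
have h := expR_ge1Dx (l / 2 * x ^+ 2).
apply: (@le_trans _ _ ((1 + l^-1) * (1 + l / 2 * x ^+ 2))); last first.
  by apply: ler_wpM2l; [rewrite addr_ge0// invr_ge0 ltW|].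
rewrite (_ : _ * _ = 1 + l^-1 + (l + 1) / 2 * x ^+ 2); last first.
  by field; rewrite gt_eqF.
have : `|x| <= (1 + x ^+ 2) / 2.
  by rewrite ler_norml; apply/andP; split; have := sqr_ge0 (x + 1); have := sqr_ge0 (x - 1); nra.
have : 0 < l^-1 by rewrite invr_gt0.
by have := sqr_ge0 x; nra.
Qed.

(** Half of the Gaussian absorbs the polynomial. *)
Lemma horner_gauss_le l p : 0 < l ->
  exists2 K, 0 <= K & forall x, `|p.[x] * gauss l x| <= K * gauss (l / 2) x.
Proof.
move=> l0; have [K K0 hK] := horner_le_gauss p (divr_gt0 l0 (ltr0n _ 2)).
exists K => // x; rewrite normrM (ger0_norm (ltW (gauss_gt0 _ _))).
have -> : gauss l x = expR (- (l / 2 * x ^+ 2)) * gauss (l / 2) x.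
  by rewrite gaussM; congr (gauss _ _); field.
rewrite mulrA ler_wpM2r ?expR_ge0// expRN ler_pdivrMr ?expR_gt0//.
Qed.

Lemma intg_horner_gauss l p : 0 < l -> mu.-intg (fun x => p.[x] * gauss l x).
Proof.
move=> l0; have [K K0 hK] := horner_gauss_le p l0.
apply: (@intg_le _ _ _ mu _ _ _ hK).
  by apply: measurable_funM; [exact: measurable_horner|exact: measurable_gauss].
by apply: intgZ; apply: intg_gauss; rewrite divr_gt0.
Qed.

Lemma sqint_horner_gauss l p : 0 < l -> sqint mu (fun x => p.[x] * gauss l x).
Proof.
move=> l0; split.
  by apply: measurable_funM; [exact: measurable_horner|exact: measurable_gauss].
have l20 : 0 < l *+ 2 by rewrite mulrn_wgt0.
by apply: intg_eq (intg_horner_gauss (p ^+ 2) l20) => x; rewrite exprMn gauss_sqr hornerE.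
Qed.

Lemma cvg_horner_gauss l p : 0 < l ->
  (p.[n%:R] * gauss l n%:R @[n --> \oo] --> 0) /\
  (p.[- n%:R] * gauss l (- n%:R) @[n --> \oo] --> 0).
Proof.
move=> l0; have [K K0 hK] := horner_gauss_le p l0.
have h0 : K / (l / 2) * (n.+1%:R)^-1 @[n --> \oo] --> (0 : R).
  by rewrite -[X in _ --> X](mulr0 (K / (l / 2))); apply: cvgMr; exact: cvg_harmonic.
(* Stated through [x ^+ 2] to serve both ends [x = n + 1] and [x = - (n + 1)]; the shift by one
   keeps the divisor positive. *)
have bnd n x : x ^+ 2 = n.+1%:R ^+ 2 -> `|p.[x] * gauss l x| <= K / (l / 2) * n.+1%:R^-1.
  move=> xn; apply: (le_trans (hK x)); rewrite -mulrA ler_wpM2l//.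
  rewrite /gauss xn expRN -invfM lef_pV2 ?posrE ?expR_gt0 ?mulr_gt0 ?divr_gt0//.
  have := expR_ge1Dx (l / 2 * n.+1%:R ^+ 2).
  have : (1 : R) <= n.+1%:R by rewrite ler1n.
  by nra.
split; rewrite -(cvg_shiftn 1); apply: norm_cvg0; apply: (squeeze_cvgr _ (cvg_cst 0) h0);
  apply: nearW => n; rewrite normr_ge0/= addn1 bnd// sqrrN//.
Qed.

(** The fundamental theorem on [[- n, n]], then dominated convergence on one side and vanishing
    boundary terms on the other. All integrations by parts below go through this lemma. *)
Lemma Rintegral_derivative (F f : R -> R) : (forall x, is_derive x 1 F (f x)) ->
  continuous f -> mu.-intg f ->
  F n%:R @[n --> \oo] --> 0 -> F (- n%:R) @[n --> \oo] --> 0 ->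
  \int[mu]_x f x = 0.
Proof.
move=> dF cf intf F0 F0'.
have mf := intg_measurable intf.
have cF : continuous F by exact: continuous_is_derive dF.
pose D n : set R := `[- n%:R, n%:R]%classic.
have FTC n : (0 < n)%N -> \int[mu]_(x in D n) f x = F n%:R - F (- n%:R).
  move=> n0; rewrite /Rintegral (@continuous_FTC2 _ f F) //=.
  - by rewrite (@lt_trans _ _ 0) ?oppr_lt0 ?ltr0n.
  - exact: continuous_subspaceT.
  - split.
    + by move=> x _; case: (dF x).
    + exact: cvg_at_right_filter (cF _).
    + exact: cvg_at_left_filter (cF _).
  - by move=> x _; rewrite derive1E; case: (dF x).
have lim1 : \int[mu]_(x in D n) f x @[n --> \oo] --> \int[mu]_x f x.
  under eq_cvg do rewrite Rintegral_mkcond.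
  apply: (@cvg_Rintegral _ _ _ mu _ _ (fun x => `|f x|)) => //.
  - move=> n; apply/(measurable_restrict f (measurable_itv _) measurableT).
    exact: measurable_funTS.
  - apply: aeW => x.
    apply: cvg_near_cst; near=> n.
    rewrite patchE ifT// inE /D /= in_itv/= -ler_norml.
    near: n; exact: nbhs_infty_ger.
  - move=> n x; rewrite patchE; case: ifP => //; rewrite normr0//.
  - exact: integrable_norm.
have lim2 : \int[mu]_(x in D n) f x @[n --> \oo] --> (0 : R).
  rewrite -(subr0 0).
  apply: cvg_trans (cvgB F0 F0'); apply: near_eq_cvg; near=> n.
  by rewrite FTC//; near: n; exact: nbhs_infty_gt.
exact: (cvg_unique _ lim1 lim2).
Unshelve. all: by end_near. Qed.

End Gaussian.

(** * Hermite functions *)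

Section Hermite.
Context {R : realType}.
Local Notation mu := (@lebesgue_measure R).
Implicit Types (p q : {poly R}) (l x : R).

Lemma Rintegral_gauss l : 0 < l -> \int[mu]_x gauss l x = Num.sqrt (pi / l).
Proof.
move=> l0; pose s := Num.sqrt ((l *+ 2)^-1).
have l20 : 0 < (l *+ 2)^-1 by rewrite invr_gt0 mulrn_wgt0.
have s0 : s != 0 by rewrite gt_eqF// sqrtr_gt0.
have : \int[mu]_x normal_pdf 0 s x = 1 by rewrite /Rintegral integral_normal_pdf.
rewrite normal_pdfE// (_ : (fun x => _) = (fun x => normal_peak s * gauss l x)).
  rewrite RintegralZl//; last exact: intg_gauss.
  move=> /(canRL (mulKf _)) ->; last by rewrite gt_eqF ?normal_peak_gt0.
  rewrite mulr1 /normal_peak invrK sqr_sqrtr ?ltW//; congr Num.sqrt.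
  by field; rewrite gt_eqF.
apply/funext => x; rewrite /normal_fun /gauss subr0 sqr_sqrtr ?ltW//; congr (_ * expR _).
by field; rewrite gt_eqF.
Qed.

Lemma Rintegral_horner_gauss_deriv l p : 0 < l ->
  \int[mu]_x ((p^`() - (2 * l) *: ('X * p)).[x] * gauss l x) = 0.
Proof.
move=> l0; have [h1 h2] := cvg_horner_gauss p l0.
apply: (Rintegral_derivative (F := fun x => p.[x] * gauss l x)) h1 h2.
- move=> x; have := is_derive_poly p x; have := is_derive_gauss l x => d1 d2.
  apply: is_derive_eq (is_deriveM d2 d1) _.
  by rewrite !hornerE /= /GRing.scale/=; ring.
- move=> x; apply: cvgM; first exact: continuous_horner.
  exact: continuous_gauss.
- exact: intg_horner_gauss.
Qed.

(** These are the polynomials [(- 1)^j exp (2 pi x^2) (d/dx)^j exp (- 2 pi x^2)], that is, the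
    physicists' Hermite polynomials in [sqrt (2 pi) x] up to the factor [(2 pi)^(j/2)]. They are not
    normalised. *)
Fixpoint hermite (j : nat) : {poly R} :=
  if j is i.+1 then (4 * pi) *: ('X * hermite i) - (hermite i)^`() else 1.

(** The commutator of differentiation with the raising operator [p |-> 4 pi x p - p'] is the scalar
    [4 pi], so each raising step adds [4 pi] to the factor. *)
Lemma deriv_hermite j : (hermite j.+1)^`() = (4 * pi * j.+1%:R) *: hermite j.
Proof.
elim: j => [|j IH].
  by rewrite /= mulr1 -polyC1 !(derivB, derivZ, derivX, derivC) subr0 mulr1.
rewrite [hermite j.+2]/= -/(hermite j.+1) derivB derivZ derivM derivX mul1r IH.
rewrite derivZ -[j.+2%:R]natr1 [hermite j.+1]/=.
move: (4 * pi) j.+1%:R => a b; rewrite -!mul_polyC (mulrDr a b 1) (mulr1 a) polyCD polyCM.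
by move: a%:P b%:P => {}a {}b; ring.
Qed.

(** The three-term recurrence, that is, the Jacobi matrix of multiplication by [x]. At [j = 0] the
    truncated [j.-1] is harmless because its coefficient is [0]. *)
Lemma mulX_hermite j :
  'X * hermite j = (4 * pi)^-1 *: hermite j.+1 + j%:R *: hermite j.-1.
Proof.
have pi0 : 4 * pi != 0 :> R by rewrite mulf_neq0// gt_eqF// pi_gt0.
rewrite [hermite j.+1]/= scalerBr scalerA mulVf// scale1r -addrA [X in _ + X](_ : _ = 0) ?addr0//.
case: j => [|j]; first by rewrite /= -polyC1 derivC scaler0 oppr0 scale0r addr0.
by rewrite deriv_hermite scalerA mulKf// addrC subrr.
Qed.

Lemma size_hermite j : size (hermite j) = j.+1.
Proof.
elim: j => [|j IH]; first by rewrite size_poly1.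
have h0 : hermite j != 0 by rewrite -size_poly_eq0 IH.
have pi0 : 4 * pi != 0 :> R by rewrite mulf_neq0// gt_eqF// pi_gt0.
rewrite /= size_polyDl size_scale// mulrC size_mulX// ?IH//.
by rewrite size_polyN (leq_trans (lt_size_deriv h0))// IH.
Qed.

Lemma hermite_span n p : (size p <= n)%N ->
  exists c : nat -> R, p = \sum_(j < n) c j *: hermite j.
Proof.
elim: n p => [|n IH] p.
  by rewrite leqn0 size_poly_eq0 => /eqP ->; exists (fun=> 0); rewrite big_ord0.
move=> sp; have h0 : (hermite n)`_n != 0.
  have := size_hermite n; rewrite -[n in _`_n]/(n.+1.-1) => <-.
  by rewrite -lead_coefE lead_coef_eq0 -size_poly_eq0 size_hermite.
(* Subtracting [a *: hermite n] cancels the coefficient of degree [n], since [hermite n] has degree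
   exactly [n]. *)
pose a := p`_n / (hermite n)`_n.
have [|c hc] := IH (p - a *: hermite n).
  apply/leq_sizeP => j; rewrite leq_eqVlt coefB coefZ => /predU1P[<-|nj].
    by rewrite /a divfK// subrr.
  rewrite [p`_j]nth_default ?(leq_trans sp)// [X in _ * X]nth_default ?size_hermite//.
  by rewrite mulr0 subr0.
exists (fun j => if j == n then a else c j).
rewrite big_ord_recr/= eqxx -[LHS](subrK (a *: hermite n)) hc; congr (_ + _).
by apply: eq_bigr => i _; rewrite ltn_eqF.
Qed.

Definition pgauss p x := p.[x] * gauss pi x.

Lemma sqint_pgauss p : sqint mu (pgauss p).
Proof. exact: sqint_horner_gauss (pi_gt0 R). Qed.

Lemma pgaussD p q x : pgauss (p + q) x = pgauss p x + pgauss q x.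
Proof. by rewrite /pgauss hornerD mulrDl. Qed.

Lemma pgaussB p q x : pgauss (p - q) x = pgauss p x - pgauss q x.
Proof. by rewrite /pgauss !hornerE mulrBl. Qed.

Lemma pgaussZ k p x : pgauss (k *: p) x = k * pgauss p x.
Proof. by rewrite /pgauss hornerZ mulrA. Qed.

Lemma pgaussX p x : pgauss ('X * p) x = x * pgauss p x.
Proof. by rewrite /pgauss hornerM hornerX mulrA. Qed.

(** The raising operator is adjoint to differentiation of the polynomial factor: the two sides
    differ by the integral of the derivative of [p q exp (- 2 pi x^2)]. *)
Lemma dot_pgauss_raise p q :
  dot mu (pgauss ((4 * pi) *: ('X * p) - p^`())) (pgauss q) =
  dot mu (pgauss p) (pgauss q^`()).
Proof.
apply/eqP; rewrite -subr_eq0 -oppr_eq0 opprB /dot -RintegralB//; last 2 first.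
- by apply: sqint_mul; exact: sqint_pgauss.
- by apply: sqint_mul; exact: sqint_pgauss.
have pi2 : 0 < pi *+ 2 :> R by rewrite mulrn_wgt0// pi_gt0.
apply/eqP; rewrite -[RHS](Rintegral_horner_gauss_deriv (p * q) pi2).
apply: eq_Rintegral => x _; rewrite -gauss_sqr /pgauss !(hornerE, derivM).
by rewrite /=; ring.
Qed.

Definition hermfun j : R -> R := pgauss (hermite j).

Definition hermnorm j := dot mu (hermfun j) (hermfun j).

Lemma hermnormS j : hermnorm j.+1 = 4 * pi * j.+1%:R * hermnorm j.
Proof.
rewrite /hermnorm /hermfun dot_pgauss_raise -/(hermite j.+1) deriv_hermite.
rewrite -dotZr; [|exact: sqint_pgauss|exact: sqint_pgauss].
by apply: eq_dot => // x; rewrite pgaussZ.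
Qed.

Lemma hermnorm_gt0 j : 0 < hermnorm j.
Proof.
elim: j => [|j IH]; last by rewrite hermnormS !mulr_gt0 ?pi_gt0.
have pi2 : 0 < pi *+ 2 :> R by rewrite mulrn_wgt0// pi_gt0.
rewrite [ltRHS](_ : _ = \int[mu]_x gauss (pi *+ 2) x).
  by rewrite Rintegral_gauss// sqrtr_gt0 divr_gt0// pi_gt0.
by apply: eq_Rintegral => x _; rewrite -gauss_sqr /hermfun /pgauss hornerC; ring.
Qed.

(** Each use of adjointness lowers both indices by one, until the derivative falls on the constant
    [hermite 0]. *)
Lemma hermfun_ortho i j : i != j -> dot mu (hermfun i) (hermfun j) = 0.
Proof.
wlog ij : i j / (j < i)%N => [h|_].
  by rewrite neq_ltn => /orP[] ij; [rewrite dotC|]; rewrite h// gtn_eqF.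
elim: j i ij => [|j IH] [|i]// ij; rewrite /hermfun dot_pgauss_raise.
  rewrite [hermite 0]/= -polyC1 derivC /dot /Rintegral integral0_eq// => x _.
  by rewrite /pgauss horner0 mul0r mulr0.
rewrite -/(hermite j.+1) deriv_hermite -(mulr0 (4 * pi * j.+1%:R)) -(IH i ij).
rewrite -dotZr; [|exact: sqint_pgauss|exact: sqint_pgauss].
by apply: eq_dot => // x; rewrite pgaussZ.
Qed.

Lemma mulX_hermfun j x :
  x * hermfun j x = (4 * pi)^-1 * hermfun j.+1 x + j%:R * hermfun j.-1 x.
Proof. by rewrite -pgaussX mulX_hermite pgaussD !pgaussZ. Qed.

End Hermite.

(** * Completeness of the Hermite functions *)

Section Elementary.
Context {R : realType}.

(** Taylor polynomials of the exponential, taken in [{poly R}] so that they can be multiplied into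
    the polynomial factor of [pgauss]. *)
Definition expPoly m : {poly R} := \sum_(k < m) (k`!%:R)^-1 *: 'X^k.

Lemma horner_expPoly m y : (expPoly m).[y] = series (exp_coeff y) m.
Proof.
rewrite /expPoly /series/= big_mkord horner_sum; apply: eq_bigr => k _.
by rewrite hornerZ hornerXn /exp_coeff/= mulrC.
Qed.

Lemma cvg_expPoly y : (expPoly m).[y] @[m --> \oo] --> expR y.
Proof.
under eq_cvg do rewrite horner_expPoly.
exact: is_cvg_series_exp_coeff.
Qed.

Lemma expPoly_le m y : `|(expPoly m).[y]| <= expR `|y|.
Proof.
rewrite horner_expPoly; apply: (@le_trans _ _ (series (exp_coeff `|y|) m)).
  rewrite /series/=; apply: (le_trans (ler_norm_sum _ _ _)); apply: ler_sum => k _.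
  by rewrite /exp_coeff/= normrM normrX normfV normr_nat.
apply: nondecreasing_cvgn_le; last exact: is_cvg_series_exp_coeff.
apply/nondecreasing_seqP => n; rewrite /series/= big_nat_recr//= lerDl.
by apply: exp_coeff_ge0.
Qed.

Lemma bernoulli_ineq (t : R) n : -1 <= t -> 1 + n%:R * t <= (1 + t) ^+ n.
Proof.
move=> t1; elim: n => [|n IH]; first by rewrite mul0r addr0 expr0.
have t10 : 0 <= 1 + t by rewrite -lerBlDl sub0r.
rewrite exprS; apply: le_trans (ler_wpM2l t10 IH).
rewrite -natr1; have : 0 <= n%:R * t ^+ 2 by rewrite mulr_ge0// sqr_ge0.
by move: n%:R => a; lra.
Qed.

(* The polynomials [(1 - s^n)^(2^n)] used in Stone-Weierstrass arguments to
   separate [s < 1/2] from [s > 1/2]. *)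
Lemma cvg_step1 (s : R) : 0 <= s -> s < 2^-1 ->
  (1 - s ^+ n) ^+ (2 ^ n) @[n --> \oo] --> (1 : R).
Proof.
move=> s0 s2.
have s1 : s <= 1 by lra.
have h : 1 - (2 * s) ^+ n @[n --> \oo] --> (1 : R).
  rewrite -[X in _ --> X](subr0 1); apply: cvgB; first exact: cvg_cst.
  by apply: cvg_expr; rewrite ger0_norm; lra.
apply: (@squeeze_cvgr _ _ _ _ _ (cst 1) _ _ _ h (cvg_cst _)).
apply: nearW => n /=.
have sn0 : 0 <= s ^+ n by rewrite exprn_ge0.
have sn1 : s ^+ n <= 1 by rewrite exprn_ile1.
rewrite exprn_ile1 ?subr_ge0 ?gerBl// andbT.
(* Bernoulli at [t = - s^n] with exponent [2^n] bounds the power below by [1 - (2 s)^n]. *)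
apply: le_trans (bernoulli_ineq _ _); last by rewrite lerN2.
by rewrite exprMn mulrN natrX.
Qed.

Lemma cvg_step0 (s : R) : 2^-1 < s -> s <= 1 ->
  (1 - s ^+ n) ^+ (2 ^ n) @[n --> \oo] --> (0 : R).
Proof.
move=> s2 s1; have s0 : 0 <= s by lra.
have h : ((2 * s)^-1) ^+ n @[n --> \oo] --> (0 : R).
  by apply: cvg_expr; rewrite ger0_norm ?invr_ge0 ?invf_lt1; lra.
apply: (@squeeze_cvgr _ _ _ _ (cst 0) _ _ _ _ (cvg_cst _) h).
apply: nearW => n /=.
have sn0 : 0 <= s ^+ n by rewrite exprn_ge0.
have sn1 : s ^+ n <= 1 by rewrite exprn_ile1.
have t0 : 0 <= 1 - s ^+ n by rewrite subr_ge0.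
rewrite exprn_ge0//= exprVn.
have P : 0 < (2 * s) ^+ n by rewrite exprn_gt0//; lra.
(* As [(1 - s^n) (1 + s^n) <= 1], an upper bound follows from a lower bound on [(1 + s^n)^(2^n)];
   Bernoulli gives [1 + (2 s)^n]. *)
have B : (2 * s) ^+ n <= (1 + s ^+ n) ^+ (2 ^ n).
  apply: le_trans (bernoulli_ineq _ _); last lra.
  by rewrite natrX exprMn lerDr.
rewrite -[leRHS]mul1r ler_pdivlMr//.
apply: (le_trans (ler_wpM2l (exprn_ge0 _ t0) B)).
by rewrite -exprMn exprn_ile1//; have := sqr_ge0 (s ^+ n); nra.
Qed.

End Elementary.

(** * Weak totality of polynomials times the Gaussian *)

Section Totality.
Context {R : realType}.
Local Notation mu := (@lebesgue_measure R).
Implicit Types (p q : {poly R}) (u v phi : R -> R).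

Variables (r : nat -> R -> R) (B : R).
Hypothesis sq_r : forall n, sqint mu (r n).
Hypothesis r_le : forall n, dot mu (r n) (r n) <= B.

Let W u := dot mu (r n) u @[n --> \oo] --> 0.

Lemma weak_eq u v : u =1 v -> W u -> W v.
Proof. by move=> /funext ->. Qed.

Lemma weakD u v : sqint mu u -> sqint mu v -> W u -> W v -> W (fun x => u x + v x).
Proof.
move=> hu hv Wu Wv; rewrite /W -[X in _ --> X](addr0 0).
by under eq_cvg do rewrite dotDr//; exact: cvgD.
Qed.

Lemma weakZ k u : sqint mu u -> W u -> W (fun x => k * u x).
Proof.
move=> hu Wu; rewrite /W -[X in _ --> X](mulr0 k).
by under eq_cvg do rewrite dotZr//; exact: cvgMr.
Qed.

Lemma weakB u v : sqint mu u -> sqint mu v -> W u -> W v -> W (fun x => u x - v x).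
Proof.
move=> hu hv Wu /(weakZ (-1) hv) Wv.
by apply: weak_eq (weakD hu (sqintZ _ hv) Wu Wv) => x; rewrite mulN1r.
Qed.

Lemma weak_sum n (u : nat -> R -> R) : (forall i, (i < n)%N -> sqint mu (u i)) ->
  (forall i, (i < n)%N -> W (u i)) -> W (fun x => \sum_(i < n) u i x).
Proof.
elim: n => [|n IH] hu Wu.
  apply: cvg_near_cst; apply: nearW => n; rewrite /dot /Rintegral integral0_eq// => x _.
  by rewrite big_ord0 mulr0.
apply: (@weak_eq (fun x => \sum_(i < n) u i x + u n x)).
  by move=> x; rewrite big_ord_recr.
apply: weakD; [apply: sqint_sum|apply: hu|apply: IH|apply: Wu] => // i ni.
- exact/hu/leqW.
- exact/hu/leqW.
- exact/Wu/leqW.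
Qed.

(** By Cauchy-Schwarz and the uniform bound [B], replacing [v] by a nearby [u m] changes all the
    products with [r n] by a small amount, uniformly in [n]. *)
Lemma weak_closed (u : nat -> R -> R) v : (forall m, sqint mu (u m)) -> sqint mu v ->
  (forall m, W (u m)) ->
  dot mu (fun x => u m x - v x) (fun x => u m x - v x) @[m --> \oo] --> 0 -> W v.
Proof.
move=> hu hv Wu uv; apply/cvgrPdist_lt => e e0.
have B0 : 0 <= B := le_trans (dot_ge0 mu (r 0)) (r_le 0).
(* Chosen so that [(B + 1) d = (e / 2)^2]; the added [1] covers [B = 0]. *)
pose d := (e / 2) ^+ 2 / (B + 1).
have d0 : 0 < d by rewrite divr_gt0 ?exprn_gt0 ?divr_gt0// ltr_wpDl.
move/cvgrPdist_lt : uv => /(_ _ d0) [m _ /(_ m (leqnn m))].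
rewrite sub0r normrN ger0_norm ?dot_ge0//= => um.
have := Wu m => /cvgrPdist_lt /(_ (e / 2)); rewrite divr_gt0// => /(_ isT).
apply: filterS => n; rewrite !sub0r !normrN => rn.
have hd := sqintB (hu m) hv.
have := cauchy_schwarz (sq_r n) hd; rewrite dotBr// => CS.
have small : `|dot mu (r n) (u m) - dot mu (r n) v| < e / 2.
  have e20 : 0 <= e / 2 by rewrite divr_ge0// ltW.
  rewrite -(ltr_pXn2r (ltn0Sn 1)) ?nnegrE//.
  rewrite real_normK ?num_real// (le_lt_trans CS)//.
  have dd := dot_ge0 mu (fun x => u m x - v x).
  apply: le_lt_trans (ler_wpM2r dd (r_le n)) _.
  apply: (@le_lt_trans _ _ ((B + 1) * dot mu (fun x => u m x - v x) (fun x => u m x - v x))).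
    by rewrite ler_wpM2r// lerDl.
  by rewrite mulrC -ltr_pdivlMr// ltr_wpDl.
rewrite (splitr e) -[dot mu (r n) v](subrK (dot mu (r n) (u m))).
by rewrite (le_lt_trans (ler_normD _ _))// ltrD// distrC.
Qed.

Lemma weak_dominated (u : nat -> R -> R) v G :
  (forall m, measurable_fun setT (u m)) -> measurable_fun setT v ->
  {ae mu, forall x, u m x @[m --> \oo] --> v x} ->
  (forall m x, `|u m x| <= G x) -> (forall x, `|v x| <= G x) -> sqint mu G ->
  (forall m, W (u m)) -> W v.
Proof.
move=> mu_ mv uv uG vG hG Wu; apply: (@weak_closed u) => //.
- by move=> m; exact: (@sqint_le _ _ _ mu _ _ (mu_ m) (uG m) hG).
- exact: (@sqint_le _ _ _ mu _ _ mv vG hG).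
- exact: (@cvg_dist_sqint _ _ _ mu _ _ _ mu_ mv uv uG vG hG).
Qed.

Hypothesis r_pgauss : forall p, W (pgauss p).

(** Quantifying over all [p] lets a factor [x - c] or a Taylor polynomial be absorbed into the
    polynomial; boundedness keeps the products in L^2. *)
Definition multiplier phi := [/\ measurable_fun setT phi,
  exists2 M, 0 <= M & forall x, `|phi x| <= M &
  forall p, W (fun x => pgauss p x * phi x)].

Lemma sqint_multiplier phi p : multiplier phi -> sqint mu (fun x => pgauss p x * phi x).
Proof.
move=> [mphi [M M0 hM] _]; have hp := sqint_pgauss p.
apply: (@sqint_le _ _ _ mu _ (fun x => M * `|pgauss p x|)).
- by apply: measurable_funM => //; case: hp.
- by move=> x; rewrite normrM mulrC ler_wpM2r.
- by apply: sqintZ; exact: sqint_norm.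
Qed.

Lemma multiplier_cst c : multiplier (cst c).
Proof.
split; first exact: measurable_cst.
- by exists `|c|.
- move=> p; apply: weak_eq (weakZ c (sqint_pgauss p) (r_pgauss p)) => x.
  by rewrite mulrC.
Qed.

Lemma multiplierD phi psi : multiplier phi -> multiplier psi ->
  multiplier (fun x => phi x + psi x).
Proof.
move=> h1 h2; case: (h1) (h2) => m1 [M1 M10 b1] W1 [m2 [M2 M20 b2] W2].
split; first exact: measurable_funD.
- exists (M1 + M2); first exact: addr_ge0.
  by move=> x; rewrite (le_trans (ler_normD _ _))// lerD.
- move=> p; apply: weak_eq (weakD (sqint_multiplier p h1) (sqint_multiplier p h2) (W1 p) (W2 p)).
  by move=> x; rewrite mulrDr.
Qed.

Definition bump (c x : R) := expR (- (2^-1 * (x - c) ^+ 2)).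

Lemma continuous_bump c : continuous (bump c).
Proof.
move=> x; apply: (@continuous_comp _ _ _ (fun y => y - c) (gauss 2^-1)).
  by apply: cvgB; [exact: cvg_id|exact: cvg_cst].
exact: continuous_gauss.
Qed.

Lemma measurable_bump c : measurable_fun setT (bump c).
Proof. by apply: continuous_measurable_fun; exact: continuous_bump. Qed.

Lemma bump_le1 c x : `|bump c x| <= 1.
Proof.
by rewrite ger0_norm ?expR_ge0// expR_le1 oppr_le0 mulr_ge0// sqr_ge0.
Qed.

Lemma weak_bump c phi p : multiplier phi ->
  W (fun x => pgauss p x * (phi x * bump c x)).
Proof.
move=> hphi; case: (hphi) => mphi [M M0 bM] Wphi.
pose Y : {poly R} := - (2^-1 *: ('X - c%:P) ^+ 2).
have YE x : Y.[x] = - (2^-1 * (x - c) ^+ 2) by rewrite !hornerE.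
have mp q : measurable_fun setT (pgauss q) by case: (sqint_pgauss q).
(* Since [(x - c)^2 / 2 <= x^2 + c^2], all Taylor polynomials are bounded by [exp (x^2 + c^2)]. This
   costs the Gaussian a factor [exp (x^2)], and what remains decays because [pi > 1]. *)
pose G x := M * expR (c ^+ 2) * `|p.[x] * gauss (pi - 1) x|.
have GE x : G x = `|pgauss p x| * (M * expR (x ^+ 2 + c ^+ 2)).
  rewrite /G /pgauss normrM [in RHS]normrM !(ger0_norm (ltW (gauss_gt0 _ _))).
  rewrite (_ : gauss (pi - 1) x = gauss pi x * expR (x ^+ 2)).
    by rewrite expRD; ring.
  by rewrite /gauss -expRD; congr expR; ring.
have Yle x : `|Y.[x]| <= x ^+ 2 + c ^+ 2.
  rewrite YE normrN ger0_norm; last by rewrite mulr_ge0// sqr_ge0.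
  by have := sqr_ge0 (x + c); nra.
apply: (@weak_dominated (fun m x => pgauss (p * (expPoly m \Po Y)) x * phi x) _ G).
- by move=> m; apply: measurable_funM.
- by apply: measurable_funM => //; apply: measurable_funM => //; exact: measurable_bump.
- apply: aeW => x.
  rewrite [pgauss p x * _](_ : _ = p.[x] * expR Y.[x] * (gauss pi x * phi x)); last first.
    by rewrite YE /pgauss /bump; ring.
  have -> : (fun m => pgauss (p * (expPoly m \Po Y)) x * phi x) =
      (fun m => p.[x] * (expPoly m).[Y.[x]] * (gauss pi x * phi x)).
    by apply/funext => m; rewrite /pgauss hornerM horner_comp; ring.
  by apply: cvgMl; apply: cvgMr; exact: cvg_expPoly.
- move=> m x; rewrite GE.
  rewrite (_ : _ * _ = pgauss p x * (phi x * (expPoly m).[Y.[x]])); last first.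
    by rewrite /pgauss hornerM horner_comp; ring.
  rewrite normrM ler_wpM2l// normrM ler_pM// (le_trans (expPoly_le _ _))//.
  by rewrite ler_expR.
- move=> x; rewrite GE normrM ler_wpM2l// normrM ler_pM//.
  rewrite (le_trans (bump_le1 _ _))// -expR0 ler_expR addr_ge0// sqr_ge0//.
- apply: sqintZ; apply: sqint_norm; apply: sqint_horner_gauss.
  by rewrite subr_gt0 (lt_le_trans _ (pi_ge2 R))// ltr1n.
- by move=> m.
Qed.

(** Lies in [[1/4, 3/4]] and is below [1/2] exactly for [x < c]. The factor [bump] makes it bounded
    without changing the sign of [x - c]. *)
Definition sigmoid (c x : R) := 2^-1 + 4^-1 * ((x - c) * bump c x).

Lemma sigmoid_bump_le c x : `|(x - c) * bump c x| <= 1.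
Proof.
rewrite normrM (ger0_norm (expR_ge0 _)) /bump expRN ler_pdivrMr ?expR_gt0// mul1r.
apply: le_trans (expR_ge1Dx _).
by rewrite ler_norml; apply/andP; split; have := sqr_ge0 (x - c - 1);
  have := sqr_ge0 (x - c + 1); nra.
Qed.

Lemma measurable_sigmoid c : measurable_fun setT (sigmoid c).
Proof.
apply: measurable_funD => //; apply: measurable_funM => //.
apply: measurable_funM; last exact: measurable_bump.
exact: measurable_funB.
Qed.

Lemma multiplier_sigmoid c phi : multiplier phi -> multiplier (fun x => phi x * sigmoid c x).
Proof.
move=> hphi; case: (hphi) => mphi [M M0 bM] Wphi; split.
- by apply: measurable_funM => //; exact: measurable_sigmoid.
- exists M => // x; rewrite normrM -[leRHS]mulr1 ler_pM//; have := sigmoid_bump_le c x.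
  by rewrite /sigmoid !ler_norml => /andP[? ?]; apply/andP; split; lra.
(* The unbounded factor [x - c] moves into the polynomial, leaving [bump] to [weak_bump]. *)
- move=> p; pose q := ('X - c%:P) * p.
  have hb p' : sqint mu (fun x => pgauss p' x * (phi x * bump c x)).
    apply: (@sqint_le _ _ _ mu _ (fun x => M * `|pgauss p' x|)).
    + apply: measurable_funM; first by case: (sqint_pgauss p').
      by apply: measurable_funM => //; exact: measurable_bump.
    + move=> x; rewrite normrM mulrC ler_wpM2r// normrM -[leRHS]mulr1 ler_pM//.
      exact: bump_le1.
    + by apply: sqintZ; apply: sqint_norm; exact: sqint_pgauss.
  have := weakD (sqintZ 2^-1 (sqint_multiplier p hphi)) (sqintZ 4^-1 (hb q))
    (weakZ 2^-1 (sqint_multiplier p hphi) (Wphi p)) (weakZ 4^-1 (hb q) (weak_bump c q hphi)).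
  by apply: weak_eq => x; rewrite /sigmoid /q /pgauss !hornerE /=; ring.
Qed.

Lemma multiplier_horner_sigmoid c q : multiplier (fun x => q.[sigmoid c x]).
Proof.
elim/poly_ind: q => [|q a IH].
  rewrite (_ : (fun x => _) = cst 0); first exact: multiplier_cst.
  by apply/funext => x; rewrite horner0.
rewrite (_ : (fun x => _) = (fun x => q.[sigmoid c x] * sigmoid c x + cst a x)).
  by apply: multiplierD; [exact: multiplier_sigmoid|exact: multiplier_cst].
by apply/funext => x; rewrite hornerMXaddC.
Qed.

Lemma pgauss1 (x : R) : pgauss 1 x = gauss pi x.
Proof. by rewrite /pgauss hornerC mul1r. Qed.

Lemma pgauss1_gt0 (x : R) : 0 < pgauss 1 x.
Proof. by rewrite pgauss1 gauss_gt0. Qed.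

Lemma pgauss1_ge0 (x : R) : 0 <= pgauss 1 x.
Proof. exact: ltW (pgauss1_gt0 x). Qed.

Let measurable_pgauss1 : measurable_fun setT (pgauss (1 : {poly R})).
Proof. by case: (sqint_pgauss (1 : {poly R})). Qed.

Lemma weak_gauss_ray c : W (fun x => pgauss 1 x * \1_(`]-oo, c[%classic) x).
Proof.
pose q m : {poly R} := (1 - 'X^m) ^+ (2 ^ m).
have qE m x : (q m).[sigmoid c x] = (1 - sigmoid c x ^+ m) ^+ (2 ^ m).
  by rewrite /q !hornerE.
have s01 x : 0 <= sigmoid c x <= 1.
  have := sigmoid_bump_le c x.
  by rewrite /sigmoid ler_norml => /andP[? ?]; apply/andP; split; lra.
apply: (@weak_dominated (fun m x => pgauss 1 x * (q m).[sigmoid c x]) _ (pgauss 1)).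
- move=> m; apply: measurable_funM => //.
  by case: (multiplier_horner_sigmoid c (q m)).
- by apply: measurable_funM => //; exact: measurable_indic.
(* At [x = c] the sigmoid equals [1/2], where neither step limit applies; the point is
   negligible. *)
- exists [set c]; split => //; first exact: lebesgue_measure_set1.
  move=> x /= nx; apply: contrapT => xc; apply: nx.
  apply: cvgMr; under eq_cvg do rewrite qE.
  have /andP[s0 s1] := s01 x.
  have b0 : 0 < bump c x by exact: expR_gt0.
  rewrite indicE; have [xc'|cx|//] := ltgtP x c.
  + rewrite mem_set ?in_itv//=; apply: cvg_step1 => //.
    rewrite /sigmoid gtrDl pmulr_rlt0 ?invr_gt0//.
    by rewrite nmulr_rlt0 ?subr_lt0.
  + rewrite memNset ?in_itv//=; last by rewrite in_itv/= ltNge (ltW cx).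
    apply: cvg_step0 => //.
    by rewrite /sigmoid ltrDl !mulr_gt0 ?invr_gt0 ?subr_gt0.
- move=> m x; rewrite normrM gtr0_norm ?pgauss1_gt0// ler_piMr ?pgauss1_ge0//.
  have /andP[s0 s1] := s01 x; rewrite qE.
  have sn0 : 0 <= sigmoid c x ^+ m by rewrite exprn_ge0.
  have sn1 : sigmoid c x ^+ m <= 1 by rewrite exprn_ile1.
  by rewrite ger0_norm ?exprn_ge0 ?exprn_ile1 ?subr_ge0 ?gerBl.
- move=> x; rewrite normrM gtr0_norm ?pgauss1_gt0// ler_piMr ?pgauss1_ge0//.
  by rewrite indicE normr_nat; case: (_ \in _).
- exact: sqint_pgauss.
- by move=> m; case: (multiplier_horner_sigmoid c (q m)).
Qed.

Lemma sqint_gauss_indic (A : set R) : measurable A ->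
  sqint mu (fun x => pgauss 1 x * \1_A x).
Proof.
move=> mA; apply: (@sqint_le _ _ _ mu _ (pgauss 1)); last exact: sqint_pgauss.
- by apply: measurable_funM => //; exact: measurable_indic.
- move=> x; rewrite normrM gtr0_norm ?pgauss1_gt0// ler_piMr ?pgauss1_ge0//.
  by rewrite indicE normr_nat; case: (_ \in _).
Qed.

(** At each point the partial sums either jump once from [0] to [1] or stay at [0], which gives both
    the pointwise limit and the bound by [1] for disjoint unions. *)
Lemma sum_indic_trivIset (F : nat -> set R) x : trivIset setT F ->
  (exists2 k, forall m, \sum_(i < m) \1_(F i) x = (k < m)%:R :> R & (\bigcup_i F i) x) \/
  (forall m, \sum_(i < m) \1_(F i) x = 0 :> R) /\ ~ (\bigcup_i F i) x.
Proof.
move=> tF; have [[k _ Fk]|nF] := pselect ((\bigcup_i F i) x); [left|right].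
  exists k; last by exists k.
  move=> m; have oth i : i != k -> \1_(F i) x = 0 :> R.
    move=> ik; rewrite indicE memNset// => Fi.
    by move: ik; rewrite (tF i k I I)// ?eqxx//; exists x.
  have [km|mk] := ltnP k m.
    rewrite (bigD1 (Ordinal km))//= big1 ?addr0 ?indicE ?mem_set// => i ik.
    by apply: oth; apply: contra_neq ik => ik; exact: val_inj.
  by rewrite big1// => i _; apply: oth; rewrite ltn_eqF// (leq_trans (ltn_ord i)).
split=> // m; rewrite big1// => i _; rewrite indicE memNset// => Fi.
by apply: nF; exists i.
Qed.

(** Dynkin's theorem: the open left rays are stable under intersection and generate the Borel sets,
    while complements and disjoint unions are handled by linearity and domination. *)
Lemma weak_gauss_indic (A : set R) : measurable A -> W (fun x => pgauss 1 x * \1_A x).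
Proof.
move=> mA; have : (@RGenInftyO.G R).-sigma.-measurable A by rewrite -RGenInftyO.measurableE.
move: A {mA}; apply: (@dynkin_induction _ _ (@RGenInftyO.G R)
  (fun A : set R => W (fun x => pgauss 1 x * \1_A x))).
- exact: RGenInftyO.measurableE.
- move=> _ _ [a ->] [b ->]; exists (Num.min a b).
  apply/seteqP; split => x /=; rewrite !in_itv/= lt_min.
    by case=> -> ->.
  by move/andP.
- by apply: weak_eq (r_pgauss 1) => x; rewrite indicT mulr1.
- by move=> _ [a ->]; exact: weak_gauss_ray.
- move=> S mS WS.
  apply: weak_eq (weakB (sqint_pgauss 1) (sqint_gauss_indic mS) (r_pgauss 1) WS) => x.
  by rewrite !indicE in_setC; case: (_ \in _) => /=; ring.
- move=> F mF tF WF.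
  have bnd m x : `|\sum_(i < m) \1_(F i) x| <= 1 :> R.
    case: (sum_indic_trivIset x tF) => [[k -> _]|[-> _]].
      by rewrite normr_nat; case: (_ < _)%N.
    by rewrite normr0.
  apply: (@weak_dominated (fun m x => \sum_(i < m) pgauss 1 x * \1_(F i) x) _ (pgauss 1)).
  + by move=> m; apply: measurable_sum => i; apply: measurable_funM => //; exact: measurable_indic.
  + by apply: measurable_funM => //; apply: measurable_indic; exact: bigcup_measurable.
  + apply: aeW => x; under eq_cvg do rewrite -mulr_sumr.
    apply: cvgMr; case: (sum_indic_trivIset x tF) => [[k hk kF]|[h0 nF]].
      under eq_cvg do rewrite hk; apply: cvg_near_cst.
      rewrite indicE mem_set//.
      near=> m; have -> : (k < m)%N by near: m; exact: nbhs_infty_gt.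
      by [].
    under eq_cvg do rewrite h0; rewrite indicE memNset//; exact: cvg_cst.
  + move=> m x; rewrite -mulr_sumr normrM gtr0_norm ?pgauss1_gt0//.
    by rewrite ler_piMr ?pgauss1_ge0.
  + move=> x; rewrite normrM gtr0_norm ?pgauss1_gt0// ler_piMr ?pgauss1_ge0//.
    by rewrite indicE normr_nat; case: (_ \in _).
  + exact: sqint_pgauss.
  + by move=> m; apply: (@weak_sum m (fun i x => pgauss 1 x * \1_(F i) x)) => i _;
      [exact: sqint_gauss_indic|exact: WF].
Unshelve. all: by end_near. Qed.

Lemma weak_nonneg f : sqint mu f -> (forall x, 0 <= f x) -> W f.
Proof.
move=> hf f0; case: (hf) => mf _.
(* [gauss (- pi)] is the inverse of [gauss pi]. The quotient [phi] need not be integrable, but it is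
   nonnegative and measurable. *)
pose phi x := f x * gauss (- pi) x.
have phi0 x : 0 <= phi x by rewrite mulr_ge0// ltW// gauss_gt0.
have fE x : f x = pgauss 1 x * phi x.
  by rewrite pgauss1 mulrCA gaussM subrr /gauss mul0r oppr0 expR0 mulr1.
have mphi : measurable_fun setT phi.
  by apply: measurable_funM => //; exact: measurable_gauss.
have mephi : measurable_fun setT (EFin \o phi) by exact/measurable_EFinP.
have ephi0 x : setT x -> (0 <= (EFin \o phi) x)%E by rewrite /= lee_fin.
(* Dyadic simple functions below [phi] that converge to it; multiplied back by the Gaussian they are
   dominated by [f] itself. *)
pose a := approx setT (EFin \o phi).
have a_le m x : a m x <= phi x.
  by rewrite -lee_fin; exact: (le_approx m ephi0).
have a0 m x : 0 <= a m x.
  by rewrite /a /approx addr_ge0 ?mulr_ge0// sumr_ge0// => i _; rewrite !mulr_ge0.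
have mA n k : measurable (dyadic_approx setT (EFin \o phi) n k).
  rewrite /dyadic_approx; case: ifPn => // _; rewrite setTI.
  rewrite (_ : [set x | _] = phi @^-1` [set` dyadic_itv R n k]); last first.
    apply/seteqP; split => x /=; first by rewrite inE => -[y + [<-]].
    by rewrite inE => h; exists (phi x).
  by rewrite -[X in measurable X]setTI; apply: mphi => //; exact: measurable_itv.
have mB n : measurable (integer_approx setT (EFin \o phi) n).
  rewrite /integer_approx setTI (_ : [set x | _] = phi @^-1` `[n%:R, +oo[%classic).
    by rewrite -[X in measurable X]setTI; apply: mphi => //; exact: measurable_itv.
  by apply/seteqP; split => x /=; rewrite lee_fin in_itv/= andbT.
apply: (@weak_dominated (fun m x => pgauss 1 x * a m x) f f) => //.
- move=> m; apply: measurable_funM => //; rewrite /a /approx.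
  apply: (measurable_funD (f := fun x => \sum_(k < m * 2 ^ m) k%:R * 2 ^- m *
    \1_(dyadic_approx setT (EFin \o phi) m k) x)).
    by apply: measurable_sum => i; exact: measurable_funM.
  exact: measurable_funM.
- apply: aeW => x; rewrite fE; apply: cvgMr.
  by apply: (@cvg_approx _ _ _ setT (EFin \o phi) x ephi0) => //=; rewrite ltry.
- move=> m x; rewrite ger0_norm; last by apply: mulr_ge0; [exact: pgauss1_ge0|exact: a0].
  by rewrite fE; apply: ler_wpM2l; [exact: pgauss1_ge0|exact: a_le].
- by move=> x; rewrite ger0_norm.
- move=> m; pose c k : R := k%:R * 2 ^- m.
  pose A k := dyadic_approx setT (EFin \o phi) m k.
  pose Bm := integer_approx setT (EFin \o phi) m.
  have sqA k : sqint mu (fun x => c k * (pgauss 1 x * \1_(A k) x)).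
    by apply: sqintZ; apply: sqint_gauss_indic; exact: mA.
  have sqB : sqint mu (fun x => m%:R * (pgauss 1 x * \1_Bm x)).
    by apply: sqintZ; apply: sqint_gauss_indic; exact: mB.
  apply: (@weak_eq (fun x => \sum_(k < m * 2 ^ m) c k * (pgauss 1 x * \1_(A k) x) +
      m%:R * (pgauss 1 x * \1_Bm x))).
    move=> x; rewrite /a /approx mulrDr mulr_sumr; congr (_ + _); last by rewrite mulrCA.
    by apply: eq_bigr => k _; rewrite mulrCA.
  apply: weakD => //.
    by apply: (@sqint_sum _ _ _ mu _ (fun k x => c k * (pgauss 1 x * \1_(A k) x))).
    apply: (@weak_sum _ (fun k x => c k * (pgauss 1 x * \1_(A k) x))) => // k _.
    apply: weakZ; first by apply: sqint_gauss_indic; exact: mA.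
    by apply: weak_gauss_indic; exact: mA.
  apply: weakZ; first by apply: sqint_gauss_indic; exact: mB.
  by apply: weak_gauss_indic; exact: mB.
Qed.

(** Apply the nonnegative case to the positive and negative parts of [f]. *)
Theorem hermite_total f : sqint mu f -> W f.
Proof.
move=> hf; have hn := sqint_norm hf.
have hp := sqintZ 2^-1 (sqintD hn hf); have hm := sqintZ 2^-1 (sqintB hn hf).
have Wp : W (fun x => 2^-1 * (`|f x| + f x)).
  apply: weak_nonneg => // x; rewrite mulr_ge0//.
  by rewrite -lerBlDr sub0r -normrN ler_norm.
have Wm : W (fun x => 2^-1 * (`|f x| - f x)).
  by apply: weak_nonneg => // x; rewrite mulr_ge0// subr_ge0 ler_norm.
by apply: weak_eq (weakB hp hm Wp Wm) => x; field.
Qed.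

End Totality.

(** * Bessel and Parseval for Hermite expansions *)

Section Parseval.
Context {R : realType}.
Local Notation mu := (@lebesgue_measure R).
Local Notation "'c_ j" := (@hermnorm R j) (at level 9, j at level 8).
Local Notation "'h_ j" := (@hermfun R j) (at level 9, j at level 8).
Variable f : R -> R.
Hypothesis hf : sqint mu f.

Let a j := dot mu f 'h_j.
Let S n := \sum_(j < n) a j ^+ 2 / 'c_j.
Let s n x := \sum_(j < n) (a j / 'c_j) * 'h_j x.
Let r n x := f x - s n x.

Let sqh j : sqint mu 'h_j. Proof. exact: sqint_pgauss. Qed.

Let sqah j : sqint mu (fun x => (a j / 'c_j) * 'h_j x).
Proof. exact: sqintZ. Qed.

Let sqs n : sqint mu (s n).
Proof. by apply: (@sqint_sum _ _ _ mu n (fun j x => (a j / 'c_j) * 'h_j x)). Qed.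

Let sqr n : sqint mu (r n).
Proof. exact: sqintB. Qed.

Let dot_s u n : sqint mu u -> dot mu (s n) u = \sum_(j < n) (a j / 'c_j) * dot mu 'h_j u.
Proof.
move=> hu; rewrite /s (@dot_suml _ _ _ mu n (fun j x => (a j / 'c_j) * 'h_j x))//.
by apply: eq_bigr => j _; rewrite dotZl.
Qed.

Let dot_sh n j : (j < n)%N -> dot mu (s n) 'h_j = a j.
Proof.
move=> jn; rewrite dot_s// (bigD1 (Ordinal jn))//= big1 ?addr0.
  by rewrite -/(hermnorm j) divfK// gt_eqF// hermnorm_gt0.
by move=> i ij; rewrite hermfun_ortho ?mulr0//; apply: contra_neq ij => ij; exact: val_inj.
Qed.

Let dot_sf n : dot mu (s n) f = S n.
Proof. by rewrite dot_s//; apply: eq_bigr => j _; rewrite dotC -/(a j) mulrAC expr2. Qed.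

Let dot_ss n : dot mu (s n) (s n) = S n.
Proof.
rewrite dot_s//; apply: eq_bigr => j _; rewrite dotC dot_sh//.
by rewrite mulrAC expr2.
Qed.

Let dot_rr n : dot mu (r n) (r n) = dot mu f f - S n.
Proof. by rewrite dotBr// !dotBl// dot_ss dot_sf dotC dot_sf; ring. Qed.

Let S_ge0 n : 0 <= S n.
Proof.
by apply: sumr_ge0 => j _; rewrite divr_ge0 ?sqr_ge0 ?ltW ?hermnorm_gt0.
Qed.

Lemma hermite_bessel n : \sum_(j < n) dot mu f 'h_j ^+ 2 / 'c_j <= dot mu f f.
Proof. by rewrite -subr_ge0 -dot_rr dot_ge0. Qed.

(** The remainders [r n] are bounded in norm by [f], and orthogonal to a given polynomial times the
    Gaussian as soon as [n] reaches the size of that polynomial. Totality, tested on [f] itself,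
    then concludes, because the product of [r n] with [f] is the defect in Bessel's inequality. *)
Lemma hermite_parseval :
  \sum_(j < n) dot mu f 'h_j ^+ 2 / 'c_j @[n --> \oo] --> dot mu f f.
Proof.
have r_le n : dot mu (r n) (r n) <= dot mu f f by rewrite dot_rr gerBl.
have r_p p : dot mu (r n) (pgauss p) @[n --> \oo] --> 0.
  have [b pE] := hermite_span (leqnn (size p)).
  apply: cvg_near_cst; near=> n.
  rewrite (@eq_dot _ _ _ mu (r n) _ (r n) (fun x => \sum_(j < size p) b j * 'h_j x))//; last first.
    move=> x; rewrite [in LHS]pE /pgauss horner_sum mulr_suml; apply: eq_bigr => j _.
    by rewrite hornerZ mulrA.
  rewrite (@dot_sumr _ _ _ mu _ (fun j x => b j * 'h_j x))//; last first.
    by move=> i _; exact: sqintZ.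
  apply: big1 => j _; rewrite dotZr// dotBl// dot_sh ?subrr ?mulr0//.
  by rewrite (leq_trans (ltn_ord j))//; near: n; exact: nbhs_infty_ge.
have := hermite_total sqr r_le r_p hf.
move=> h; apply/subr_cvg0; rewrite -[X in _ --> X]oppr0.
rewrite (_ : (fun n => _) = (fun n => - dot mu (r n) f)); first exact: cvgN.
by apply/funext => n; rewrite dotBl// dot_sf opprB.
Unshelve. all: by end_near. Qed.

End Parseval.

(** * Fourier transforms of Hermite functions *)

Section CosSinTransform.
Context {R : realType}.
Local Notation mu := (@lebesgue_measure R).
Implicit Types (p q : {poly R}) (u v : R -> R) (x xi : R).

(** For real [u] the Fourier transform is [ft_cos u - i ft_sin u]. *)
Definition ft_cos u xi := \int[mu]_x (u x * cos (2 * pi * x * xi)).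
Definition ft_sin u xi := \int[mu]_x (u x * sin (2 * pi * x * xi)).

Lemma is_derive_cosM (a x : R) : is_derive x 1 (fun y => cos (a * y)) (- (a * sin (a * x))).
Proof.
rewrite (_ : (fun y => _) = cos \o (fun y => a * y)); last by apply/funext.
by apply: is_derive_eq; rewrite /= /GRing.scale/=; ring.
Qed.

Lemma is_derive_sinM (a x : R) : is_derive x 1 (fun y => sin (a * y)) (a * cos (a * x)).
Proof.
rewrite (_ : (fun y => _) = sin \o (fun y => a * y)); last by apply/funext.
by apply: is_derive_eq; rewrite /= /GRing.scale/=; ring.
Qed.

Lemma measurable_cosM (a : R) : measurable_fun setT (fun y => cos (a * y)).
Proof.
by apply: continuous_measurable_fun; apply: continuous_is_derive (is_derive_cosM a).
Qed.

Lemma measurable_sinM (a : R) : measurable_fun setT (fun y => sin (a * y)).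
Proof.
by apply: continuous_measurable_fun; apply: continuous_is_derive (is_derive_sinM a).
Qed.

Lemma intg_mul_cos u xi : mu.-intg u -> mu.-intg (fun x => u x * cos (2 * pi * x * xi)).
Proof.
move=> iu; apply: (@intg_le _ _ _ mu _ (fun x => `|u x|)).
- apply: measurable_funM; first exact: (intg_measurable iu).
  by rewrite (_ : (fun x => _) = (fun x => cos (2 * pi * xi * x)));
    [exact: measurable_cosM|apply/funext => x; rewrite mulrAC].
- by move=> x; rewrite normrM ler_piMr// ler_norml cos_geN1 cos_le1.
- exact: integrable_norm.
Qed.

Lemma intg_mul_sin u xi : mu.-intg u -> mu.-intg (fun x => u x * sin (2 * pi * x * xi)).
Proof.
move=> iu; apply: (@intg_le _ _ _ mu _ (fun x => `|u x|)).
- apply: measurable_funM; first exact: (intg_measurable iu).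
  by rewrite (_ : (fun x => _) = (fun x => sin (2 * pi * xi * x)));
    [exact: measurable_sinM|apply/funext => x; rewrite mulrAC].
- by move=> x; rewrite normrM ler_piMr// ler_norml sin_geN1 sin_le1.
- exact: integrable_norm.
Qed.

Lemma intg_pgauss p : mu.-intg (pgauss p).
Proof. exact: intg_horner_gauss (pi_gt0 R). Qed.

Lemma ft_cosB p q xi :
  ft_cos (pgauss (p - q)) xi = ft_cos (pgauss p) xi - ft_cos (pgauss q) xi.
Proof.
rewrite /ft_cos -RintegralB//; [|exact/intg_mul_cos/intg_pgauss..].
by apply: eq_Rintegral => x _; rewrite pgaussB mulrBl.
Qed.

Lemma ft_sinB p q xi :
  ft_sin (pgauss (p - q)) xi = ft_sin (pgauss p) xi - ft_sin (pgauss q) xi.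
Proof.
rewrite /ft_sin -RintegralB//; [|exact/intg_mul_sin/intg_pgauss..].
by apply: eq_Rintegral => x _; rewrite pgaussB mulrBl.
Qed.

Lemma ft_cosZ k p xi : ft_cos (pgauss (k *: p)) xi = k * ft_cos (pgauss p) xi.
Proof.
rewrite /ft_cos -RintegralZl//; last exact/intg_mul_cos/intg_pgauss.
by apply: eq_Rintegral => x _; rewrite pgaussZ mulrA.
Qed.

Lemma ft_sinZ k p xi : ft_sin (pgauss (k *: p)) xi = k * ft_sin (pgauss p) xi.
Proof.
rewrite /ft_sin -RintegralZl//; last exact/intg_mul_sin/intg_pgauss.
by apply: eq_Rintegral => x _; rewrite pgaussZ mulrA.
Qed.

Lemma is_derive_pgauss p x :
  is_derive x 1 (pgauss p) (pgauss (p^`() - (2 * pi) *: ('X * p)) x).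
Proof.
have d1 := is_derive_gauss pi x; have d2 := is_derive_poly p x.
apply: is_derive_eq (is_deriveM d2 d1) _.
by rewrite /pgauss !hornerE /= /GRing.scale/=; ring.
Qed.

Lemma cvg_pgauss_bounded p (b : R -> R) : (forall x, `|b x| <= 1) ->
  (pgauss p n%:R * b n%:R @[n --> \oo] --> 0) /\
  (pgauss p (- n%:R) * b (- n%:R) @[n --> \oo] --> 0).
Proof.
move=> b1; have [h1 h2] := cvg_horner_gauss p (pi_gt0 R).
split; apply: norm_cvg0.
- have h : `|pgauss p n%:R| @[n --> \oo] --> (0 : R).
    by rewrite -[X in _ --> X](@normr0 _ R); exact: cvg_norm h1.
  apply: (@squeeze_cvgr _ _ _ _ (cst 0) _ _ _ _ (cvg_cst _) h); apply: nearW => n /=.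
  by rewrite normr_ge0/= normrM ler_piMr.
- have h : `|pgauss p (- n%:R)| @[n --> \oo] --> (0 : R).
    by rewrite -[X in _ --> X](@normr0 _ R); exact: cvg_norm h2.
  apply: (@squeeze_cvgr _ _ _ _ (cst 0) _ _ _ _ (cvg_cst _) h); apply: nearW => n /=.
  by rewrite normr_ge0/= normrM ler_piMr.
Qed.

(** The derivative in [x] of [pgauss p x * cos (2 pi x xi)] has integral zero; the term in [x p] is
    solved for. *)
Lemma ft_cosX p xi : ft_cos (pgauss ('X * p)) xi =
  (2 * pi)^-1 * ft_cos (pgauss p^`()) xi - xi * ft_sin (pgauss p) xi.
Proof.
have pi0 : 2 * pi != 0 :> R by rewrite mulf_neq0// gt_eqF// pi_gt0.
pose a := 2 * pi * xi.
have [l1 l2] := @cvg_pgauss_bounded p (fun x => cos (a * x))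
  (fun x => ltac:(rewrite ler_norml cos_geN1 cos_le1; reflexivity)).
pose D x := pgauss (p^`() - (2 * pi) *: ('X * p)) x * cos (2 * pi * x * xi) -
   a * (pgauss p x * sin (2 * pi * x * xi)).
have iD : mu.-intg D.
  by apply: intgB; [|apply: intgZ]; [exact/intg_mul_cos/intg_pgauss|exact/intg_mul_sin/intg_pgauss].
have : \int[mu]_x D x = 0.
  apply: (@Rintegral_derivative _ (fun x => pgauss p x * cos (a * x))) => //.
  - move=> x; apply: is_derive_eq (is_deriveM (is_derive_pgauss p x) (is_derive_cosM a x)) _.
    by rewrite /D /GRing.scale/= /a (mulrAC _ x xi); ring.
  - have cp q : continuous (pgauss q) by exact: continuous_is_derive (is_derive_pgauss q).
    rewrite /D => x; apply: cvgB.
      apply: cvgM; first exact: cp.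
      under eq_fun do rewrite mulrAC.
      by rewrite mulrAC; exact: continuous_is_derive (is_derive_cosM _) x.
    apply: cvgMr; apply: cvgM; first exact: cp.
    under eq_fun do rewrite mulrAC.
    by rewrite mulrAC; exact: continuous_is_derive (is_derive_sinM _) x.
rewrite RintegralB//; last 2 first.
- exact/intg_mul_cos/intg_pgauss.
- exact/intgZ/intg_mul_sin/intg_pgauss.
rewrite RintegralZl//; last exact/intg_mul_sin/intg_pgauss.
rewrite -/(ft_cos _ xi) -/(ft_sin _ xi) ft_cosB ft_cosZ /a.
move: (ft_cos _ _) (ft_cos _ _) (ft_sin _ _) => A B C h.
by apply: (mulfI pi0); rewrite mulrBr mulVKf//; lra.
Qed.

Lemma ft_sinX p xi : ft_sin (pgauss ('X * p)) xi =
  (2 * pi)^-1 * ft_sin (pgauss p^`()) xi + xi * ft_cos (pgauss p) xi.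
Proof.
have pi0 : 2 * pi != 0 :> R by rewrite mulf_neq0// gt_eqF// pi_gt0.
pose a := 2 * pi * xi.
have [l1 l2] := @cvg_pgauss_bounded p (fun x => sin (a * x))
  (fun x => ltac:(rewrite ler_norml sin_geN1 sin_le1; reflexivity)).
pose D x := pgauss (p^`() - (2 * pi) *: ('X * p)) x * sin (2 * pi * x * xi) +
   a * (pgauss p x * cos (2 * pi * x * xi)).
have iD : mu.-intg D.
  by apply: intgD; [|apply: intgZ]; [exact/intg_mul_sin/intg_pgauss|exact/intg_mul_cos/intg_pgauss].
have : \int[mu]_x D x = 0.
  apply: (@Rintegral_derivative _ (fun x => pgauss p x * sin (a * x))) => //.
  - move=> x; apply: is_derive_eq (is_deriveM (is_derive_pgauss p x) (is_derive_sinM a x)) _.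
    by rewrite /D /GRing.scale/= /a (mulrAC _ x xi); ring.
  - have cp q : continuous (pgauss q) by exact: continuous_is_derive (is_derive_pgauss q).
    rewrite /D => x; apply: cvgD.
      apply: cvgM; first exact: cp.
      under eq_fun do rewrite mulrAC.
      by rewrite mulrAC; exact: continuous_is_derive (is_derive_sinM _) x.
    apply: cvgMr; apply: cvgM; first exact: cp.
    under eq_fun do rewrite mulrAC.
    by rewrite mulrAC; exact: continuous_is_derive (is_derive_cosM _) x.
rewrite RintegralD//; last 2 first.
- exact/intg_mul_sin/intg_pgauss.
- exact/intgZ/intg_mul_cos/intg_pgauss.
rewrite RintegralZl//; last exact/intg_mul_cos/intg_pgauss.
rewrite -/(ft_cos _ xi) -/(ft_sin _ xi) ft_sinB ft_sinZ /a.
move: (ft_sin _ _) (ft_sin _ _) (ft_cos _ _) => A B C h.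
by apply: (mulfI pi0); rewrite (mulrDr (2 * pi)) mulVKf//; lra.
Qed.

Lemma is_derive_under_integral (f df : R -> R -> R) (G : R -> R) (xi : R) :
  (forall y, mu.-intg (f y)) ->
  (forall x y : R, is_derive y 1 (f ^~ x) (df y x)) ->
  (forall x y, `|df y x| <= G x) -> mu.-intg G ->
  is_derive xi 1 (fun y => \int[mu]_x f y x) (\int[mu]_x df xi x).
Proof.
move=> intf dfE dfG iG.
have G0 x : 0 <= G x by exact: le_trans (normr_ge0 _) (dfG x 0).
have d1E y x : partial1of2 f y x = df y x.
  by rewrite partial1of2E; case: (dfE x y).
(* Differentiation under the integral is local; since the bound [G] holds everywhere, the radius [1]
   is arbitrary. *)
have Ia : xi \in `](xi - 1), (xi + 1)[ by rewrite in_itv/= gtrBl ltrDl ltr01.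
have intf' x : `](xi - 1), (xi + 1)[%classic x -> mu.-intg (f x) by move=> _; exact: intf.
have der x y : `](xi - 1), (xi + 1)[%classic x -> setT y -> derivable (f ^~ y) x 1.
  by move=> _ _; case: (dfE y x).
have ub x y : `](xi - 1), (xi + 1)[%classic x -> setT y -> `|partial1of2 f x y| <= G y.
  by move=> _ _; rewrite d1E.
have H1 := derivable_under_integral measurableT Ia intf' der G0 iG ub.
have H2 := differentiation_under_integral measurableT Ia intf' der G0 iG ub.
apply: DeriveDef => //; rewrite -derive1E H2.
by apply: eq_Rintegral => x _; exact: d1E.
Qed.

Lemma is_derive_ft_cos p xi :
  is_derive xi 1 (ft_cos (pgauss p)) (- (2 * pi) * ft_sin (pgauss ('X * p)) xi).
Proof.
rewrite /ft_sin -RintegralZl//; last exact/intg_mul_sin/intg_pgauss.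
apply: (@is_derive_under_integral (fun y x => pgauss p x * cos (2 * pi * x * y))
  (fun y x => - (2 * pi) * (pgauss ('X * p) x * sin (2 * pi * x * y)))
  (fun x => 2 * pi * `|pgauss ('X * p) x|)).
- by move=> y; exact/intg_mul_cos/intg_pgauss.
- move=> x y; have d := is_derive_cosM (2 * pi * x) y.
  apply: is_derive_eq (is_deriveZ (pgauss p x) d) _.
  by rewrite pgaussX /GRing.scale/=; ring.
- have p20 : 0 <= 2 * pi :> R by rewrite mulr_ge0 ?pi_ge0.
  move=> x y; rewrite normrM normrN (ger0_norm p20) ler_wpM2l// normrM ler_piMr//.
  by rewrite ler_norml sin_geN1 sin_le1.
- by apply: intgZ; apply: integrable_norm => //; exact: intg_pgauss.
Qed.

Lemma is_derive_ft_sin p xi :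
  is_derive xi 1 (ft_sin (pgauss p)) (2 * pi * ft_cos (pgauss ('X * p)) xi).
Proof.
rewrite /ft_cos -RintegralZl//; last exact/intg_mul_cos/intg_pgauss.
apply: (@is_derive_under_integral (fun y x => pgauss p x * sin (2 * pi * x * y))
  (fun y x => 2 * pi * (pgauss ('X * p) x * cos (2 * pi * x * y)))
  (fun x => 2 * pi * `|pgauss ('X * p) x|)).
- by move=> y; exact/intg_mul_sin/intg_pgauss.
- move=> x y; have d := is_derive_sinM (2 * pi * x) y.
  apply: is_derive_eq (is_deriveZ (pgauss p x) d) _.
  by rewrite pgaussX /GRing.scale/=; ring.
- have p20 : 0 <= 2 * pi :> R by rewrite mulr_ge0 ?pi_ge0.
  move=> x y; rewrite normrM (ger0_norm p20) ler_wpM2l// normrM ler_piMr//.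
  by rewrite ler_norml cos_geN1 cos_le1.
- by apply: intgZ; apply: integrable_norm => //; exact: intg_pgauss.
Qed.

(** The product of [y] with [gauss (- l)] has zero derivative, hence is constant. *)
Lemma gauss_ode (l : R) (y : R -> R) :
  (forall x, is_derive x 1 y (- (2 * l * x) * y x)) ->
  forall x, y x = y 0 * gauss l x.
Proof.
move=> hy x; have d (z : R) : is_derive z 1 (fun z => y z * gauss (- l) z) 0.
  apply: is_derive_eq (is_deriveM (hy z) (is_derive_gauss (- l) z)) _.
  by rewrite /GRing.scale/=; ring.
have := is_derive_0_is_cst x 0 d.
have g0 m : gauss m 0 = 1 by rewrite /gauss expr0n mulr0 oppr0 expR0.
rewrite g0 mulr1 => <-; rewrite -mulrA gaussM addNr /gauss mul0r oppr0 expR0 mulr1//.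
Qed.

(** Differentiating in [xi] and then integrating by parts gives [y' = - 2 pi xi y], with [y 0] the
    total mass [1] of [gauss pi]. *)
Lemma ft_cos_gauss xi : ft_cos (pgauss 1) xi = pgauss 1 xi.
Proof.
have d x : is_derive x 1 (ft_cos (pgauss 1)) (- (2 * pi * x) * ft_cos (pgauss 1) x).
  apply: is_derive_eq (is_derive_ft_cos 1 x) _.
  rewrite ft_sinX -polyC1 derivC -[0](scale0r 1) ft_sinZ mul0r mulr0 add0r; ring.
rewrite (gauss_ode d) /pgauss hornerC; congr (_ * _).
rewrite /ft_cos (_ : (fun x => _) = gauss pi).
  by rewrite Rintegral_gauss ?pi_gt0// divff ?sqrtr1// gt_eqF// pi_gt0.
by apply/funext => x; rewrite mulr0 cos0 hornerC mulr1 mul1r.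
Qed.

Lemma ft_sin_gauss xi : ft_sin (pgauss 1) xi = 0.
Proof.
have d x : is_derive x 1 (ft_sin (pgauss 1)) (- (2 * pi * x) * ft_sin (pgauss 1) x).
  apply: is_derive_eq (is_derive_ft_sin 1 x) _.
  rewrite ft_cosX -polyC1 derivC -[0](scale0r 1) ft_cosZ mul0r mulr0 add0r; ring.
rewrite (gauss_ode d) {1}/ft_sin (_ : Rintegral _ _ _ = 0) ?mul0r//.
by rewrite /Rintegral integral0_eq// => x _; rewrite mulr0 sin0 mulr0.
Qed.

(* [quarter j = (c, s)] with [(- i)^j = c - i s]. *)
Fixpoint quarter (j : nat) : R * R :=
  if j is i.+1 then (- (quarter i).2, (quarter i).1) else (1, 0).

Lemma quarter_norm j : (quarter j).1 ^+ 2 + (quarter j).2 ^+ 2 = 1.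
Proof. by elim: j => [|j IH] /=; [|rewrite -IH]; ring. Qed.

(** The transform carries the raising operator to itself times [- i]. The induction is strong
    because the derivative of [hermite j] brings in [hermite j.-1]. *)
Lemma ft_hermfun j xi :
  ft_cos (hermfun j) xi = (quarter j).1 * hermfun j xi /\
  ft_sin (hermfun j) xi = (quarter j).2 * hermfun j xi.
Proof.
have pi0 : 2 * pi != 0 :> R by rewrite mulf_neq0// gt_eqF// pi_gt0.
suff : forall k, (k <= j)%N -> ft_cos (hermfun k) xi = (quarter k).1 * hermfun k xi /\
  ft_sin (hermfun k) xi = (quarter k).2 * hermfun k xi by apply.
elim: j => [|j IH] k.
  rewrite leqn0 => /eqP ->; rewrite /hermfun /= ft_cos_gauss ft_sin_gauss.
  by rewrite mul1r mul0r.
rewrite leq_eqVlt => /predU1P[->{k}|]; last exact: IH.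
have [IHc IHs] := IH j (leqnn j).
(* The derivative enters twice with a plus sign through multiplication by [x], and once with a minus
   sign through the recurrence, which leaves it once. *)
have step : ft_cos (hermfun j.+1) xi =
      ft_cos (pgauss (hermite j)^`()) xi - 4 * pi * xi * ft_sin (hermfun j) xi /\
    ft_sin (hermfun j.+1) xi =
      ft_sin (pgauss (hermite j)^`()) xi + 4 * pi * xi * ft_cos (hermfun j) xi.
  rewrite /hermfun [@hermite _ j.+1]/= ft_cosB ft_sinB ft_cosZ ft_sinZ ft_cosX ft_sinX.
  have e : 4 * pi * (2 * pi)^-1 = 2 :> R.
    by rewrite (_ : 4 * pi = 2 * (2 * pi)) ?mulfK//; ring.
  by rewrite (mulrBr (4 * pi)) (mulrDr (4 * pi)) !(mulrA (4 * pi) (2 * pi)^-1) e; split; ring.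
have hE : hermfun j.+1 xi = 4 * pi * xi * hermfun j xi - pgauss (hermite j)^`() xi.
  by rewrite /hermfun [@hermite _ j.+1]/= pgaussB pgaussZ pgaussX; ring.
(* The derivative is a multiple of the Hermite function of index [j - 1], whose phase
   [(- i)^(j - 1)] is the opposite of [(- i)^(j + 1)]. *)
have der : ft_cos (pgauss (hermite j)^`()) xi = - (quarter j.+1).1 * pgauss (hermite j)^`() xi /\
    ft_sin (pgauss (hermite j)^`()) xi = - (quarter j.+1).2 * pgauss (hermite j)^`() xi.
  case: j {hE step IHc IHs} IH => [|j] IH.
    rewrite /= -polyC1 derivC -[0 : {poly R}](scale0r 1) ft_cosZ ft_sinZ pgaussZ.
    by rewrite !mul0r !mulr0.
  have [e1 e2] := IH j (leqnSn j).
  rewrite deriv_hermite ft_cosZ ft_sinZ pgaussZ -/(hermfun j) e1 e2 /=.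
  by split; ring.
case: step => -> ->; case: der => -> ->; rewrite IHc IHs hE /=.
by split; ring.
Qed.

End CosSinTransform.

(** * Fubini for integral operators with a bounded kernel *)

Section KernelFubini.
Context {R : realType}.
Local Notation mu := (@lebesgue_measure R).
Implicit Types (u h : R -> R).

Lemma intg_prod u h : mu.-intg u -> mu.-intg h ->
  (mu \x mu)%E.-intg (fun z => u z.1 * h z.2).
Proof.
move=> iu ih; have mu1 := intg_measurable iu; have mh := intg_measurable ih.
have mf : measurable_fun setT (EFin \o (fun z : R * R => u z.1 * h z.2)).
  apply/measurable_EFinP; apply: measurable_funM.
    by apply: (@measurableT_comp _ _ _ _ _ _ u) => //; exact: measurable_fst.
  by apply: (@measurableT_comp _ _ _ _ _ _ h) => //; exact: measurable_snd.
apply: (integrable12ltyP mu mu mf).2.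
have H (y : R) : (\int[mu]_x `|(u y * h x)%R%:E| = (`|u y| * \int[mu]_x `|h x|)%R%:E)%E.
  have fin : (\int[mu]_x `|h x|%:E)%E \is a fin_num.
    by apply: integrable_fin_num => //; exact: integrable_norm.
  rewrite EFinM /Rintegral (fineK fin) -ge0_integralZl//.
  - by apply: eq_integral => x _ /=; rewrite normrM EFinM.
  - by apply/measurable_EFinP; exact: measurableT_comp.
under eq_integral do rewrite /= H.
have := intgZ (\int[mu]_x `|h x|) (integrable_norm iu).
move=> /integrableP[_]; apply: le_lt_trans; rewrite le_eqVlt; apply/orP; left; apply/eqP.
apply: eq_integral => x _ /=; rewrite [in RHS]ger0_norm 1?mulrC// mulr_ge0//.
by apply: Rintegral_ge0.
Qed.

Variable K : R * R -> R.
Hypothesis mK : measurable_fun setT K.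
Hypothesis K1 : forall z, `|K z| <= 1.

Let G u y := \int[mu]_x (u x * K (x, y)).

Let intg_K u h : mu.-intg u -> mu.-intg h ->
  (mu \x mu)%E.-intg (fun z => u z.1 * K z * h z.2).
Proof.
move=> iu ih; have := integrable_norm (intg_prod iu ih).
have mu1 := intg_measurable iu; have mh := intg_measurable ih.
apply: intg_le.
- apply: measurable_funM; first apply: measurable_funM => //.
    by apply: (@measurableT_comp _ _ _ _ _ _ u) => //; exact: measurable_fst.
  by apply: (@measurableT_comp _ _ _ _ _ _ h) => //; exact: measurable_snd.
- by move=> z; rewrite /= !normrM mulrAC -[leRHS]mulr1 ler_pM ?mulr_ge0.
Qed.

Let GE u h : mu.-intg u -> mu.-intg h -> forall y,
  (\int[mu]_x (u x * K (x, y) * h y)%:E)%E = (G u y * h y)%:E.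
Proof.
move=> iu ih y.
have iuK : mu.-intg (fun x => u x * K (x, y)).
  apply: (@intg_le _ _ _ mu _ (fun x => `|u x|)).
  - apply: measurable_funM; first exact: (intg_measurable iu).
    apply: (measurableT_comp mK).
    exact: measurable_fun_pair.
  - by move=> x; rewrite normrM ler_piMr.
  - exact: integrable_norm.
have iuKh : mu.-intg (fun x => u x * K (x, y) * h y).
  by apply: intg_eq (intgZ (h y) iuK) => x; rewrite mulrC.
rewrite /G -RintegralZr// /Rintegral fineK//.
exact: integrable_fin_num.
Qed.

(* [u(x) K(x, y)] is not integrable in [(x, y)]; it becomes so after multiplication
   by a Gaussian in [y], which can be divided out afterwards. *)
Lemma measurable_kernel_transform u : mu.-intg u -> measurable_fun setT (G u).
Proof.
move=> iu; have ig := intg_gauss (@ltr01 R).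
have m1 : measurable_fun setT (fun y => G u y * gauss 1 y).
  apply/measurable_EFinP; rewrite (_ : _ \o _ = fubini_G mu
    (EFin \o (fun z => u z.1 * K z * gauss 1 z.2))); last first.
    by apply/funext => y; rewrite /fubini_G /= (GE iu ig y).
  by have := measurable_fubini_G (intg_K iu ig).
have := measurable_funM m1 (measurable_gauss (-1)).
congr measurable_fun; apply/funext => y /=.
by rewrite -mulrA gaussM subrr /gauss mul0r oppr0 expR0 mulr1.
Qed.

(** As [|K| <= 1], the function [u(x) K(x, y) h(y)] is dominated by the integrable [|u(x) h(y)|], so
    the order of integration can be exchanged. *)
Lemma kernel_transform_adjoint u h : mu.-intg u -> mu.-intg h ->
  \int[mu]_y (G u y * h y) = \int[mu]_x (u x * \int[mu]_y (K (x, y) * h y)).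
Proof.
move=> iu ih; have I := intg_K iu ih.
have := Fubini I => /(congr1 fine) /=.
under [in X in _ = X -> _]eq_integral do rewrite (GE iu ih).
move=> E; rewrite [LHS]/Rintegral -E; congr fine; apply: eq_integral => x _.
have iKh : mu.-intg (fun y => K (x, y) * h y).
  apply: (@intg_le _ _ _ mu _ (fun x => `|h x|)).
  - apply: measurable_funM; last exact: (intg_measurable ih).
    by apply: (measurableT_comp mK); exact: measurable_fun_pair.
  - by move=> y; rewrite normrM ler_piMl.
  - exact: integrable_norm.
rewrite -RintegralZl// /Rintegral fineK; first by apply: eq_integral => y _; rewrite mulrA.
by apply: integrable_fin_num => //; exact: intgZ.
Qed.

End KernelFubini.

(** * Symmetry of the cosine and sine transforms *)

Section TransformAdjoint.
Context {R : realType}.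
Local Notation mu := (@lebesgue_measure R).
Implicit Types (u h : R -> R).

Let Kc (z : R * R) := cos (2 * pi * z.1 * z.2).
Let Ks (z : R * R) := sin (2 * pi * z.1 * z.2).

Let measurable_prod : measurable_fun setT (fun z : R * R => 2 * pi * z.1 * z.2).
Proof.
apply: measurable_funM; last exact: measurable_snd.
by apply: measurable_funM => //; exact: measurable_fst.
Qed.

Let mKc : measurable_fun setT Kc.
Proof.
apply: (@measurableT_comp _ _ _ _ _ _ (@cos R)) => //.
by apply: continuous_measurable_fun; exact: continuous_cos.
Qed.

Let mKs : measurable_fun setT Ks.
Proof.
apply: (@measurableT_comp _ _ _ _ _ _ (@sin R)) => //.
by apply: continuous_measurable_fun; exact: continuous_sin.
Qed.

Let Kc1 z : `|Kc z| <= 1. Proof. by rewrite ler_norml cos_geN1 cos_le1. Qed.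
Let Ks1 z : `|Ks z| <= 1. Proof. by rewrite ler_norml sin_geN1 sin_le1. Qed.

Lemma measurable_ft_cos u : mu.-intg u -> measurable_fun setT (ft_cos u).
Proof. exact: (@measurable_kernel_transform _ Kc). Qed.

Lemma measurable_ft_sin u : mu.-intg u -> measurable_fun setT (ft_sin u).
Proof. exact: (@measurable_kernel_transform _ Ks). Qed.

Lemma ft_cos_adjoint u h : mu.-intg u -> mu.-intg h -> dot mu (ft_cos u) h = dot mu u (ft_cos h).
Proof.
move=> iu ih; rewrite [LHS](@kernel_transform_adjoint _ Kc)//.
apply: eq_Rintegral => x _; congr (_ * _); apply: eq_Rintegral => y _.
by rewrite mulrC /Kc/= mulrAC.
Qed.

Lemma ft_sin_adjoint u h : mu.-intg u -> mu.-intg h -> dot mu (ft_sin u) h = dot mu u (ft_sin h).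
Proof.
move=> iu ih; rewrite [LHS](@kernel_transform_adjoint _ Ks)//.
apply: eq_Rintegral => x _; congr (_ * _); apply: eq_Rintegral => y _.
by rewrite mulrC /Ks/= mulrAC.
Qed.

(** Symmetry moves the transform onto the Hermite function, an eigenfunction, so the coefficient is
    found without knowing that [ft_cos u] is square-integrable. *)
Lemma dot_ft_cos u j : mu.-intg u -> sqint mu u ->
  dot mu (ft_cos u) (hermfun j) = (quarter j).1 * dot mu u (hermfun j).
Proof.
move=> iu su; rewrite ft_cos_adjoint//; last exact: intg_pgauss.
rewrite -dotZr//; last exact: sqint_pgauss.
by apply: eq_dot => // x; have [] := ft_hermfun j x.
Qed.

Lemma dot_ft_sin u j : mu.-intg u -> sqint mu u ->
  dot mu (ft_sin u) (hermfun j) = (quarter j).2 * dot mu u (hermfun j).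
Proof.
move=> iu su; rewrite ft_sin_adjoint//; last exact: intg_pgauss.
rewrite -dotZr//; last exact: sqint_pgauss.
by apply: eq_dot => // x; have [] := ft_hermfun j x.
Qed.

End TransformAdjoint.

(** * Hermite coefficients of the Fourier transform *)

Section ComplexL2.
Context {R : realType}.
Local Notation mu := (@lebesgue_measure R).
Implicit Types (f g w : R -> R[i]) (h : R -> R).

Definition cre f x := complex.Re (f x).
Definition cim f x := complex.Im (f x).

Lemma sqr_modulus (z : R[i]) : modulus z ^+ 2 = complex.Re z ^+ 2 + complex.Im z ^+ 2.
Proof.
by case: z => a b; rewrite /modulus /= sqr_sqrtr// addr_ge0// sqr_ge0.
Qed.

Lemma modulus_ge0 (z : R[i]) : 0 <= modulus z.
Proof. by case: z => a b; rewrite /modulus /= sqrtr_ge0. Qed.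

Lemma Lfun2_sqint h : h \in Lfun mu 2%:E -> sqint mu h.
Proof.
move=> h2; split; last exact: Lfun2_integrable_sqr.
by move: h2; rewrite inE => /andP[]; rewrite inE.
Qed.

Lemma inLp2_sqint f : inLp 2%:E f -> sqint mu (cre f) /\ sqint mu (cim f).
Proof. by move=> [/Lfun2_sqint ? /Lfun2_sqint ?]. Qed.

Lemma inLp1_intg f : inLp 1 f -> mu.-intg (cre f) /\ mu.-intg (cim f).
Proof. by move=> [/Lfun1_integrable ? /Lfun1_integrable ?]. Qed.

Lemma poweR_L2norm w :
  (L2norm w `^ 2 = \int[mu]_x (cre w x ^+ 2 + cim w x ^+ 2)%R%:E)%E.
Proof.
rewrite /L2norm powR_Lnorm//; apply: eq_integral => x _.
rewrite /= ger0_norm ?modulus_ge0// powR_mulrn ?modulus_ge0// sqr_modulus//.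
Qed.

Lemma L2norm_ge0 w : (0 <= L2norm w)%E.
Proof. exact: Lnorm_ge0. Qed.

Lemma L2norm_sqint w : sqint mu (cre w) -> sqint mu (cim w) ->
  L2norm w \is a fin_num /\
  fine (L2norm w) ^+ 2 = dot mu (cre w) (cre w) + dot mu (cim w) (cim w).
Proof.
move=> hr hi; have E := poweR_L2norm w.
have ir := sqint_mul hr hr; have ii := sqint_mul hi hi.
have F : (L2norm w `^ 2 = (dot mu (cre w) (cre w) + dot mu (cim w) (cim w))%R%:E)%E.
  rewrite E /dot -RintegralD// /Rintegral fineK.
    by apply: eq_integral => x _; rewrite !expr2.
  by apply: integrable_fin_num => //; exact: intgD.
have := L2norm_ge0 w; case: (L2norm w) F => [n| |]//.
  by move=> F; rewrite lee_fin => n0; move: F; rewrite /= powR_mulrn// => -[->].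
by rewrite poweRyr.
Qed.

Lemma sqint_L2norm w : measurable_fun setT (cre w) -> measurable_fun setT (cim w) ->
  (L2norm w < +oo)%E -> sqint mu (cre w) /\ sqint mu (cim w).
Proof.
move=> mr mi lty.
have i2 : mu.-intg (fun x => cre w x ^+ 2 + cim w x ^+ 2).
  apply/integrableP; split.
    by apply/measurable_EFinP; apply: measurable_funD; exact: measurable_funX.
  have := poweR_lty 2 lty; rewrite poweR_L2norm; apply: le_lt_trans.
  rewrite le_eqVlt; apply/orP; left; apply/eqP; apply: eq_integral => x _ /=.
  by rewrite ger0_norm// addr_ge0// sqr_ge0.
by split; split => //; apply: (@intg_le _ _ _ mu _ _ _ _ i2); [exact: measurable_funX|
  move=> x; rewrite ger0_norm ?sqr_ge0// ?lerDl ?lerDr ?sqr_ge0|exact: measurable_funX|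
  move=> x; rewrite ger0_norm ?sqr_ge0// ?lerDl ?lerDr ?sqr_ge0].
Qed.

(** The norms are finite only eventually, so just measurability is assumed of [w_ n]; square
    integrability is recovered for large [n], and Cauchy-Schwarz applies. *)
Lemma L2norm0_dot (w_ : nat -> R -> R[i]) h :
  (forall n, measurable_fun setT (cre (w_ n))) ->
  (forall n, measurable_fun setT (cim (w_ n))) ->
  L2norm (w_ n) @[n --> \oo] --> 0%E -> sqint mu h ->
  dot mu (cre (w_ n)) h @[n --> \oo] --> 0 /\
  dot mu (cim (w_ n)) h @[n --> \oo] --> 0.
Proof.
move=> mr mi w0 hh.
have H e : 0 < e -> \forall n \near \oo,
    `|dot mu (cre (w_ n)) h| < e /\ `|dot mu (cim (w_ n)) h| < e.
  move=> e0; have hp : 0 < dot mu h h + 1 by rewrite ltr_wpDl// dot_ge0.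
  (* With [H = dot mu h h], this gives [d^2 H < e^2], because [H < (H + 1)^2]. *)
  pose d := e / (dot mu h h + 1).
  have d0 : 0 < d by rewrite divr_gt0.
  have /fine_cvgP[finw] := w0.
  move=> /cvgrPdist_lt /(_ d d0) wd.
  near=> n.
  have fn : L2norm (w_ n) \is a fin_num by near: n.
  have /= : `|0 - fine (L2norm (w_ n))| < d by near: n.
  rewrite sub0r normrN ger0_norm ?fine_ge0 ?L2norm_ge0// => nd.
  have lty : (L2norm (w_ n) < +oo)%E by rewrite ltey_eq fn.
  have [sr si] := sqint_L2norm (mr n) (mi n) lty.
  have [_ E] := L2norm_sqint sr si.
  have N2 : fine (L2norm (w_ n)) ^+ 2 * dot mu h h < e ^+ 2.
    have L0 := fine_ge0 (L2norm_ge0 (w_ n)).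
    apply: (@le_lt_trans _ _ (d ^+ 2 * dot mu h h)).
      by rewrite ler_wpM2r ?dot_ge0// lerXn2r ?nnegrE// ltW.
    rewrite /d exprMn -mulrA gtr_pMr ?exprn_gt0// exprVn mulrC ltr_pdivrMr ?exprn_gt0// mul1r.
    by have := dot_ge0 mu h; nra.
  have rr := dot_ge0 mu (cre (w_ n)); have ii := dot_ge0 mu (cim (w_ n)).
  by split; rewrite -(ltr_pXn2r (ltn0Sn 1)) ?nnegrE// 1?ltW// real_normK ?num_real//;
    apply: le_lt_trans N2; [apply: le_trans (cauchy_schwarz sr hh) _
                           |apply: le_trans (cauchy_schwarz si hh) _];
    rewrite ler_wpM2r ?dot_ge0// E ?lerDl ?lerDr.
split; apply/cvgrPdist_lt => e e0; have := H e e0; apply: filterS => n [];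
  by rewrite sub0r normrN.
Unshelve. all: by end_near. Qed.

Lemma Re_mul_expi (z : R[i]) t :
  complex.Re (z * expi t) = complex.Re z * cos t - complex.Im z * sin t.
Proof. by case: z. Qed.

Lemma Im_mul_expi (z : R[i]) t :
  complex.Im (z * expi t) = complex.Re z * sin t + complex.Im z * cos t.
Proof. by case: z. Qed.

Lemma cre_fourierL1 f : inLp 1 f ->
  cre (fourierL1 f) = (fun xi => ft_cos (cre f) xi + ft_sin (cim f) xi).
Proof.
move=> /inLp1_intg[ir ii]; apply/funext => xi.
rewrite /ft_cos /ft_sin -RintegralD//; [|exact: intg_mul_cos|exact: intg_mul_sin].
apply: eq_Rintegral => x _; rewrite Re_mul_expi cosN sinN /cre /cim; ring.
Qed.

Lemma cim_fourierL1 f : inLp 1 f ->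
  cim (fourierL1 f) = (fun xi => ft_cos (cim f) xi - ft_sin (cre f) xi).
Proof.
move=> /inLp1_intg[ir ii]; apply/funext => xi.
rewrite /ft_cos /ft_sin -RintegralB//; [|exact: intg_mul_cos|exact: intg_mul_sin].
apply: eq_Rintegral => x _; rewrite Im_mul_expi cosN sinN /cre /cim; ring.
Qed.

End ComplexL2.

(** * Coefficients of the Fourier transform and Plancherel's identity *)

Section Plancherel.
Context {R : realType}.
Local Notation mu := (@lebesgue_measure R).
Implicit Types (f g : R -> R[i]) (h : R -> R).

Lemma creB f g : cre (fun x => f x - g x) = (fun x => cre f x - cre g x).
Proof. by apply/funext => x; rewrite /cre; case: (f x) (g x) => a b [c d]. Qed.

Lemma cimB f g : cim (fun x => f x - g x) = (fun x => cim f x - cim g x).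
Proof. by apply/funext => x; rewrite /cim; case: (f x) (g x) => a b [c d]. Qed.

Lemma sqint_hermfun j : sqint mu (hermfun j).
Proof. exact: sqint_pgauss. Qed.

(** Only the products with [h] are assumed integrable, so that the lemma also covers
    [fourierL1 (f_ n)], not yet known to be square-integrable. *)
Lemma L2cvg_dot (f_ : nat -> R -> R[i]) f h :
  (forall n, measurable_fun setT (cre (f_ n))) ->
  (forall n, measurable_fun setT (cim (f_ n))) ->
  (forall n, mu.-intg (fun x => cre (f_ n) x * h x)) ->
  (forall n, mu.-intg (fun x => cim (f_ n) x * h x)) ->
  sqint mu (cre f) -> sqint mu (cim f) -> sqint mu h -> L2cvg f_ f ->
  dot mu (cre (f_ n)) h @[n --> \oo] --> dot mu (cre f) h /\
  dot mu (cim (f_ n)) h @[n --> \oo] --> dot mu (cim f) h.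
Proof.
move=> mr mi ir ii sr si sh cv.
have [] := @L2norm0_dot _ (fun n x => f_ n x - f x) h _ _ cv sh.
- by move=> n; rewrite creB; apply: measurable_funB => //; case: sr.
- by move=> n; rewrite cimB; apply: measurable_funB => //; case: si.
have Er n : dot mu (cre (fun x => f_ n x - f x)) h = dot mu (cre (f_ n)) h - dot mu (cre f) h.
  rewrite creB /dot -RintegralB//; last exact: sqint_mul.
  by apply: eq_Rintegral => x _; rewrite mulrBl.
have Ei n : dot mu (cim (fun x => f_ n x - f x)) h = dot mu (cim (f_ n)) h - dot mu (cim f) h.
  rewrite cimB /dot -RintegralB//; last exact: sqint_mul.
  by apply: eq_Rintegral => x _; rewrite mulrBl.
move=> hr hi; split; apply/subr_cvg0.
- by rewrite -(funext Er).
- by rewrite -(funext Ei).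
Qed.

(** The transform of [u] is bounded by the integral of [|u|]. *)
Lemma intg_ft_cos_mul u h : mu.-intg u -> mu.-intg h -> mu.-intg (fun x => ft_cos u x * h x).
Proof.
move=> iu ih; apply: (@intg_le _ _ _ mu _ (fun x => (\int[mu]_y `|u y|) * `|h x|)).
- by apply: measurable_funM; [exact: measurable_ft_cos|exact: intg_measurable ih].
- move=> x; rewrite normrM ler_wpM2r//.
  apply: (le_trans (le_normr_Rintegral _ _)) => //; first exact: intg_mul_cos.
  apply: le_Rintegral => //.
  + by apply: integrable_norm => //; exact: intg_mul_cos.
  + exact: integrable_norm.
  + by move=> y _; rewrite normrM ler_piMr// ler_norml cos_geN1 cos_le1.
- by apply: intgZ; exact: integrable_norm.
Qed.

Lemma intg_ft_sin_mul u h : mu.-intg u -> mu.-intg h -> mu.-intg (fun x => ft_sin u x * h x).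
Proof.
move=> iu ih; apply: (@intg_le _ _ _ mu _ (fun x => (\int[mu]_y `|u y|) * `|h x|)).
- by apply: measurable_funM; [exact: measurable_ft_sin|exact: intg_measurable ih].
- move=> x; rewrite normrM ler_wpM2r//.
  apply: (le_trans (le_normr_Rintegral _ _)) => //; first exact: intg_mul_sin.
  apply: le_Rintegral => //.
  + by apply: integrable_norm => //; exact: intg_mul_sin.
  + exact: integrable_norm.
  + by move=> y _; rewrite normrM ler_piMr// ler_norml sin_geN1 sin_le1.
- by apply: intgZ; exact: integrable_norm.
Qed.

(** In complex form, the coefficient of [g] is [(- i)^j] times that of [f]. This holds for each
    approximant by symmetry of the transforms, and both sides pass to the L^2 limit. *)
Lemma fourier_hermite f g j : is_fourier f g ->
  dot mu (cre g) (hermfun j) =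
    (quarter j).1 * dot mu (cre f) (hermfun j) + (quarter j).2 * dot mu (cim f) (hermfun j) /\
  dot mu (cim g) (hermfun j) =
    (quarter j).1 * dot mu (cim f) (hermfun j) - (quarter j).2 * dot mu (cre f) (hermfun j).
Proof.
move=> [/inLp2_sqint[fr fi] /inLp2_sqint[gr gi] [f_ [f12 ff fg]]].
have sr n : sqint mu (cre (f_ n)) by have [_ /inLp2_sqint[]] := f12 n.
have si n : sqint mu (cim (f_ n)) by have [_ /inLp2_sqint[]] := f12 n.
have ir n : mu.-intg (cre (f_ n)) by have [/inLp1_intg[]] := f12 n.
have ii n : mu.-intg (cim (f_ n)) by have [/inLp1_intg[]] := f12 n.
have sh := sqint_hermfun j; have ih : mu.-intg (hermfun j) by exact: intg_pgauss.
have [lr li] : dot mu (cre (f_ n)) (hermfun j) @[n --> \oo] --> dot mu (cre f) (hermfun j) /\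
    dot mu (cim (f_ n)) (hermfun j) @[n --> \oo] --> dot mu (cim f) (hermfun j).
  apply: L2cvg_dot => //.
  - by move=> n; case: (sr n).
  - by move=> n; case: (si n).
  - by move=> n; exact: sqint_mul.
  - by move=> n; exact: sqint_mul.
have Er n : cre (fourierL1 (f_ n)) = fun xi => ft_cos (cre (f_ n)) xi + ft_sin (cim (f_ n)) xi.
  by apply: cre_fourierL1; have [] := f12 n.
have Ei n : cim (fourierL1 (f_ n)) = fun xi => ft_cos (cim (f_ n)) xi - ft_sin (cre (f_ n)) xi.
  by apply: cim_fourierL1; have [] := f12 n.
have [Lr Li] : dot mu (cre (fourierL1 (f_ n))) (hermfun j) @[n --> \oo] -->
      dot mu (cre g) (hermfun j) /\
    dot mu (cim (fourierL1 (f_ n))) (hermfun j) @[n --> \oo] --> dot mu (cim g) (hermfun j).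
  apply: L2cvg_dot => //.
  - by move=> n; rewrite Er; apply: measurable_funD;
      [exact: measurable_ft_cos|exact: measurable_ft_sin].
  - by move=> n; rewrite Ei; apply: measurable_funB;
      [exact: measurable_ft_cos|exact: measurable_ft_sin].
  - move=> n; rewrite Er.
    by apply: intg_eq (intgD (intg_ft_cos_mul (ir n) ih) (intg_ft_sin_mul (ii n) ih)) => x;
      rewrite mulrDl.
  - move=> n; rewrite Ei.
    by apply: intg_eq (intgB (intg_ft_cos_mul (ii n) ih) (intg_ft_sin_mul (ir n) ih)) => x;
      rewrite mulrBl.
have Dr n : dot mu (cre (fourierL1 (f_ n))) (hermfun j) =
    (quarter j).1 * dot mu (cre (f_ n)) (hermfun j) +
    (quarter j).2 * dot mu (cim (f_ n)) (hermfun j).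
  rewrite -dot_ft_cos// -dot_ft_sin// Er /dot -RintegralD//; last 2 first.
  - exact: intg_ft_cos_mul.
  - exact: intg_ft_sin_mul.
  by apply: eq_Rintegral => x _; rewrite mulrDl.
have Di n : dot mu (cim (fourierL1 (f_ n))) (hermfun j) =
    (quarter j).1 * dot mu (cim (f_ n)) (hermfun j) -
    (quarter j).2 * dot mu (cre (f_ n)) (hermfun j).
  rewrite -dot_ft_cos// -dot_ft_sin// Ei /dot -RintegralB//; last 2 first.
  - exact: intg_ft_cos_mul.
  - exact: intg_ft_sin_mul.
  by apply: eq_Rintegral => x _; rewrite mulrBl.
rewrite (funext Dr) in Lr; rewrite (funext Di) in Li.
split.
- apply: (cvg_unique (@Rhausdorff R) Lr); exact: cvgD (cvgMr lr) (cvgMr li).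
- apply: (cvg_unique (@Rhausdorff R) Li); exact: cvgB (cvgMr li) (cvgMr lr).
Qed.

(** The squared modulus of the coefficient of [f] on the normalised Hermite function. *)
Definition weight f j :=
  (dot mu (cre f) (hermfun j) ^+ 2 + dot mu (cim f) (hermfun j) ^+ 2) / hermnorm j.

Lemma weight_ge0 f j : 0 <= weight f j.
Proof. by rewrite divr_ge0 ?addr_ge0 ?sqr_ge0// ltW// hermnorm_gt0. Qed.

Lemma weight_parseval f : sqint mu (cre f) -> sqint mu (cim f) ->
  \sum_(j < n) weight f j @[n --> \oo] --> dot mu (cre f) (cre f) + dot mu (cim f) (cim f).
Proof.
move=> sr si.
have E n : \sum_(j < n) weight f j =
    \sum_(j < n) dot mu (cre f) (hermfun j) ^+ 2 / hermnorm j +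
    \sum_(j < n) dot mu (cim f) (hermfun j) ^+ 2 / hermnorm j.
  by rewrite -big_split/=; apply: eq_bigr => j _; rewrite -mulrDl.
by rewrite (funext E); apply: cvgD; exact: hermite_parseval.
Qed.

Lemma weight_fourier f g j : is_fourier f g -> weight g j = weight f j.
Proof.
move=> /(fourier_hermite j)[er ei]; rewrite /weight er ei; congr (_ / _).
by rewrite -[RHS]mul1r -(@quarter_norm R j); ring.
Qed.

(** Both squared norms are limits of the same partial sums of weights. *)
Lemma plancherel f g : is_fourier f g ->
  dot mu (cre g) (cre g) + dot mu (cim g) (cim g) =
  dot mu (cre f) (cre f) + dot mu (cim f) (cim f).
Proof.
move=> fg; have [/inLp2_sqint[fr fi] /inLp2_sqint[gr gi] _] := fg.
have E n : \sum_(j < n) weight g j = \sum_(j < n) weight f j.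
  by apply: eq_bigr => j _; exact: weight_fourier.
have := weight_parseval gr gi; rewrite (funext E) => L.
exact: (cvg_unique (@Rhausdorff R) L (weight_parseval fr fi)).
Qed.

End Plancherel.

(** * Moments and weights *)

Section SecondMoment.
Context {R : realType}.
Local Notation mu := (@lebesgue_measure R).
Implicit Types (f : R -> R[i]).

(** For a unit vector the variance is the second moment minus the squared mean, so the second moment
    is at most [C^2 + C^2]. *)
Lemma second_moment_le f (C : R) : 0 <= C -> sqint mu (cre f) -> sqint mu (cim f) ->
  dot mu (cre f) (cre f) + dot mu (cim f) (cim f) = 1 ->
  (dispersion f <= C%:E)%E -> `|mean f| <= C ->
  let xr x := x * cre f x in let xi x := x * cim f x in
  [/\ sqint mu xr, sqint mu xi & dot mu xr xr + dot mu xi xi <= 2 * C ^+ 2].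
Proof.
move=> C0 sr si N1 dC mC xr xi.
have [_ L2] := L2norm_sqint sr si.
have [mr _] := sr; have [mi _] := si.
have mxr : measurable_fun setT xr by exact: measurable_funM.
have mxi : measurable_fun setT xi by exact: measurable_funM.
pose m2 x := cre f x ^+ 2 + cim f x ^+ 2.
have m2E x : modulus (f x) ^+ 2 = m2 x by rewrite sqr_modulus.
have m20 x : 0 <= m2 x by rewrite addr_ge0 ?sqr_ge0.
have Vle : (fun_variance f <= (C ^+ 2)%:E)%E.
  rewrite -lee_sqrt ?lee_fin ?sqr_ge0// /= sqrtr_sqr ger0_norm//.
(* A finite dispersion excludes the infinite branch of [fun_variance], so the second moment is
   finite. *)
have ix2 : mu.-intg (fun x => x ^+ 2 * m2 x).
  apply/integrableP; split.
    apply/measurable_EFinP; apply: measurable_funM; first exact: measurable_funX.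
    by apply: measurable_funD; exact: measurable_funX.
  move: Vle; rewrite /fun_variance; case: eqP => [_|/eqP ny _].
    by rewrite leNgt ltry.
  rewrite -ltey in ny; apply: le_lt_trans ny.
  rewrite le_eqVlt; apply/orP; left; apply/eqP; apply: eq_integral => x _ /=.
  by rewrite m2E ger0_norm// mulr_ge0// sqr_ge0.
have sxr : sqint mu xr.
  split => //; apply: (@intg_le _ _ _ mu _ _ _ _ ix2); first exact: measurable_funX.
  move=> x; rewrite ger0_norm ?sqr_ge0// /xr exprMn ler_wpM2l ?sqr_ge0//.
  by rewrite /m2 lerDl sqr_ge0.
have sxi : sqint mu xi.
  split => //; apply: (@intg_le _ _ _ mu _ _ _ _ ix2); first exact: measurable_funX.
  move=> x; rewrite ger0_norm ?sqr_ge0// /xi exprMn ler_wpM2l ?sqr_ge0//.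
  by rewrite /m2 lerDr sqr_ge0.
split => //.
have irr := sqint_mul sr sr; have iii := sqint_mul si si.
have im2 : mu.-intg m2.
  by apply: intg_eq (intgD irr iii) => x; rewrite /m2 !expr2.
have im1 : mu.-intg (fun x => x * m2 x).
  apply: intg_eq (intgD (sqint_mul sxr sr) (sqint_mul sxi si)) => x.
  by rewrite /m2 /xr /xi; ring.
pose M2 := dot mu xr xr + dot mu xi xi.
have M2E : \int[mu]_x (x ^+ 2 * m2 x) = M2.
  rewrite /M2 /dot -RintegralD//; [|exact: sqint_mul|exact: sqint_mul].
  by apply: eq_Rintegral => x _; rewrite /m2 /xr /xi; ring.
have N2E : \int[mu]_x m2 x = 1.
  rewrite -[RHS]N1 /dot -RintegralD//.
have mE : mean f = \int[mu]_x (x * m2 x).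
  rewrite /mean L2 N1 invr1 mul1r; apply: eq_Rintegral => x _.
  by rewrite m2E.
set m := mean f in mE mC Vle *.
have VE : \int[mu]_x ((x - m) ^+ 2 * m2 x) = M2 - m ^+ 2.
  rewrite (_ : (fun x => _) =
      (fun x => (x ^+ 2 * m2 x - 2 * m * (x * m2 x)) + m ^+ 2 * m2 x)); last first.
    by apply/funext => x; ring.
  have i1 := intgZ (2 * m) im1; have i2 := intgZ (m ^+ 2) im2.
  rewrite RintegralD//; last exact: intgB.
  rewrite RintegralB// !RintegralZl// M2E N2E -mE; ring.
have : M2 - m ^+ 2 <= C ^+ 2.
  rewrite -VE -lee_fin; move: Vle; rewrite /fun_variance; case: eqP => [_|_ h].
    by rewrite leNgt ltry.
  apply: le_trans h; rewrite le_eqVlt; apply/orP; left; apply/eqP.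
  rewrite /Rintegral fineK.
    by apply: eq_integral => x _; rewrite m2E real_normK// num_real.
  apply: integrable_fin_num => //.
  apply: (@intg_eq _ _ _ mu (fun x => (x ^+ 2 * m2 x - 2 * m * (x * m2 x)) + m ^+ 2 * m2 x)).
    by move=> x; ring.
  by apply: intgD; [apply: intgB => //|]; exact: intgZ.
have : m ^+ 2 <= C ^+ 2.
  by rewrite -(real_normK (num_real m)) lerXn2r// nnegrE.
rewrite -/M2; lra.
Qed.

End SecondMoment.

(** * Inequalities for weighted sums *)

Section Combinatorics.
Context {R : realFieldType}.
Implicit Types (w : nat -> R).

(** After reindexing, [w j] receives [j] from one term and [j + 1] from the other; what is left over
    at the indices [J] and [J + 1] is nonnegative. *)
Lemma sum_odd_shift w J : (forall j, 0 <= w j) ->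
  \sum_(j < J) (2 * j%:R + 1) * w j <=
  \sum_(j < J.+1) (j.+1%:R * w j.+1 + j%:R * w j.-1).
Proof.
move=> w0.
have -> : \sum_(j < J.+1) (j.+1%:R * w j.+1 + j%:R * w j.-1) =
    \sum_(j < J) (2 * j%:R + 1) * w j + J%:R * w J + J.+1%:R * w J.+1.
  elim: J => [|J IH]; first by rewrite big_ord_recr !big_ord0 /=; ring.
  rewrite big_ord_recr IH big_ord_recr/= -!natr1; ring.
by rewrite -addrA lerDl addr_ge0// mulr_ge0.
Qed.

(** The sum of [(2 j + 1 - 2 n) w j] is least when [w] is [1] for [j < n] and [0] beyond, with value
    [- n^2]. Keeping the total weight explicit allows a passage to the limit in [J]. *)
Lemma sum_odd_lower w n J : (forall j, 0 <= w j) -> (forall j, w j <= 1) ->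
  2 * n%:R * \sum_(j < J) w j - n%:R ^+ 2 <= \sum_(j < J) (2 * j%:R + 1) * w j.
Proof.
move=> w0 w1.
(* The right-hand side is [n^2 - (n - m)^2], the sum of the first [m] coefficients
   [2 n - 2 j - 1]. *)
have small m : (m <= n)%N ->
    2 * n%:R * \sum_(j < m) w j - \sum_(j < m) (2 * j%:R + 1) * w j <=
    2 * n%:R * m%:R - m%:R ^+ 2.
  elim: m => [|m IH] mn; first by rewrite !big_ord0 !mulr0 expr0n !subr0.
  have := IH (ltnW mn); rewrite !big_ord_recr/=.
  have : m.+1%:R <= n%:R :> R by rewrite ler_nat.
  have := w0 m; have := w1 m; rewrite -natr1.
  by move: (\sum_(j < m) _) (\sum_(j < m) _) => a b; nra.
rewrite lerBlDr addrC -lerBlDr.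
elim: J => [|J IH]; first by rewrite !big_ord0 mulr0 subr0 sqr_ge0.
have [Jn|nJ] := leqP J.+1 n.
  by apply: le_trans (small _ Jn) _; have := sqr_ge0 (n%:R - J.+1%:R : R); nra.
rewrite !big_ord_recr/=; move: IH.
have : n%:R <= J%:R :> R by rewrite ler_nat -ltnS.
by have := w0 J; move: (\sum_(j < J) _) (\sum_(j < J) _) => a b; nra.
Qed.

End Combinatorics.

(** * Bessel's inequality for a complex orthonormal family and a real function *)

Section ComplexBessel.
Context {R : realType}.
Local Notation mu := (@lebesgue_measure R).
Implicit Types (e : nat -> R -> R[i]) (h : R -> R).

Lemma L2inner_dot (f g : R -> R[i]) : sqint mu (cre f) -> sqint mu (cim f) ->
  sqint mu (cre g) -> sqint mu (cim g) ->
  L2inner f g = (dot mu (cre f) (cre g) + dot mu (cim f) (cim g)) +i*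
    (dot mu (cim f) (cre g) - dot mu (cre f) (cim g)).
Proof.
move=> fr fi gr gi; rewrite /L2inner /Cintegral /dot -RintegralD//; [|exact: sqint_mul..].
rewrite -RintegralB//; [|exact: sqint_mul..].
by congr (_ +i* _); apply: eq_Rintegral => x _; rewrite /cre /cim;
  case: (f x) (g x) => a b [c d] /=; ring.
Qed.

Lemma complex_bessel e n h :
  (forall k, (k < n)%N -> sqint mu (cre (e k)) /\ sqint mu (cim (e k))) ->
  (forall j k, (j < n)%N -> (k < n)%N -> L2inner (e j) (e k) = (j == k)%:R) ->
  sqint mu h ->
  \sum_(k < n) (dot mu (cre (e k)) h ^+ 2 + dot mu (cim (e k)) h ^+ 2) <= dot mu h h.
Proof.
move=> se oe sh.
pose A k := dot mu (cre (e k)) h; pose B k := dot mu (cim (e k)) h.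
have sr k : (k < n)%N -> sqint mu (cre (e k)) by move=> /se[].
have si k : (k < n)%N -> sqint mu (cim (e k)) by move=> /se[].
have o1 j k : (j < n)%N -> (k < n)%N ->
    dot mu (cre (e j)) (cre (e k)) + dot mu (cim (e j)) (cim (e k)) = (j == k)%:R.
  move=> jn kn; have := oe j k jn kn; rewrite L2inner_dot;
    [|by apply: sr|by apply: si|by apply: sr|by apply: si].
  by case: (j == k) => -[].
have o2 j k : (j < n)%N -> (k < n)%N ->
    dot mu (cim (e j)) (cre (e k)) - dot mu (cre (e j)) (cim (e k)) = 0.
  move=> jn kn; have := oe j k jn kn; rewrite L2inner_dot;
    [|by apply: sr|by apply: si|by apply: sr|by apply: si].
  by case: (j == k) => -[].
(* [qr k + i qi k] is [(A k - i B k) e_k], the component of [h] along [e_k]; hence [Qr + i Qi] is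
   the orthogonal projection of [h]. *)
pose qr k x := A k * cre (e k) x + B k * cim (e k) x.
pose qi k x := A k * cim (e k) x - B k * cre (e k) x.
pose Qr x := \sum_(k < n) qr k x; pose Qi x := \sum_(k < n) qi k x.
have spr k : (k < n)%N -> sqint mu (qr k).
  by move=> kn; apply: sqintD; apply: sqintZ; [exact: sr|exact: si].
have spi k : (k < n)%N -> sqint mu (qi k).
  by move=> kn; apply: sqintB; apply: sqintZ; [exact: si|exact: sr].
have sPr : sqint mu Qr by exact: (@sqint_sum _ _ _ mu n qr).
have sPi : sqint mu Qi by exact: (@sqint_sum _ _ _ mu n qi).
have dpr k v : (k < n)%N -> sqint mu v ->
    dot mu (qr k) v = A k * dot mu (cre (e k)) v + B k * dot mu (cim (e k)) v.
  by move=> kn sv; have s1 := sr k kn; have s2 := si k kn; rewrite dotDl ?dotZl//; exact: sqintZ.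
have dpi k v : (k < n)%N -> sqint mu v ->
    dot mu (qi k) v = A k * dot mu (cim (e k)) v - B k * dot mu (cre (e k)) v.
  by move=> kn sv; have s1 := sr k kn; have s2 := si k kn; rewrite dotBl ?dotZl//; exact: sqintZ.
have dPr v : sqint mu v -> dot mu Qr v = \sum_(k < n) dot mu (qr k) v.
  by move=> sv; rewrite (@dot_suml _ _ _ mu n qr).
have dPi v : sqint mu v -> dot mu Qi v = \sum_(k < n) dot mu (qi k) v.
  by move=> sv; rewrite (@dot_suml _ _ _ mu n qi).
pose S := \sum_(k < n) (A k ^+ 2 + B k ^+ 2).
have hPr : dot mu Qr h = S.
  by rewrite dPr//; apply: eq_bigr => k _; rewrite dpr// -/(A k) -/(B k) !expr2.
have c1 k l : (k < n)%N -> (l < n)%N ->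
    dot mu (qr k) (cre (e l)) + dot mu (qi k) (cim (e l)) = A k * (k == l)%:R.
  move=> kn ln; rewrite dpr ?dpi//; [|exact: si|exact: sr].
  by rewrite -(o1 k l kn ln); have /subr0_eq -> := o2 k l kn ln; ring.
have c2 k l : (k < n)%N -> (l < n)%N ->
    dot mu (qr k) (cim (e l)) - dot mu (qi k) (cre (e l)) = B k * (k == l)%:R.
  move=> kn ln; rewrite dpr ?dpi//; [|exact: sr|exact: si].
  by rewrite -(o1 k l kn ln); have /subr0_eq -> := o2 k l kn ln; ring.
have diag (F : nat -> R) l : (l < n)%N -> \sum_(k < n) F k * (k == l :> nat)%:R = F l.
  move=> ln; rewrite (bigD1 (Ordinal ln))//= eqxx mulr1 big1 ?addr0// => k kl.
  rewrite (_ : (k == l :> nat) = false) ?mulr0//.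
  by apply/negbTE; apply: contra_neq kl => kl; exact: val_inj.
have PP : dot mu Qr Qr + dot mu Qi Qi = S.
  have c1' l : (l < n)%N -> dot mu Qr (cre (e l)) + dot mu Qi (cim (e l)) = A l.
    move=> ln; rewrite dPr; last exact: sr.
    rewrite dPi; last exact: si.
    by rewrite -big_split/= -[RHS](diag A l ln); apply: eq_bigr => k _; rewrite c1.
  have c2' l : (l < n)%N -> dot mu Qr (cim (e l)) - dot mu Qi (cre (e l)) = B l.
    move=> ln; rewrite dPr; last exact: si.
    rewrite dPi; last exact: sr.
    by rewrite -sumrB/= -[RHS](diag B l ln); apply: eq_bigr => k _; rewrite c2.
  rewrite {1}dPr// dPi// -big_split/=; apply: eq_bigr => k _.
  rewrite dpr// dpi// !(dotC mu (cre (e k))) !(dotC mu (cim (e k))).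
  rewrite [LHS](_ : _ = A k * (dot mu Qr (cre (e k)) + dot mu Qi (cim (e k))) +
     B k * (dot mu Qr (cim (e k)) - dot mu Qi (cre (e k)))); last by ring.
  by rewrite c1'// c2'// !expr2.
(* The squared norm of [h - (Qr + i Qi)] is that of [h], minus [2 S], plus [S]. *)
have := dot_ge0 mu (fun x => h x - Qr x); have := dot_ge0 mu Qi.
rewrite dotBl ?dotBr//; last exact: sqintB.
rewrite (dotC mu h Qr) hPr -/S; move: PP; lra.
Qed.

End ComplexBessel.

(** The parallelogram identity for [P z1] and [n z0], with [z = a + i b], whose second pair is
    rotated by [c - i s]. Opposite phases are required only after multiplication by [n], which
    permits [n = 0]. *)
Lemma rotation_parallelogram (K : comNzRingType) (P n a1 b1 a0 b0 c1 s1 c0 s0 : K) :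
  n * c1 = - (n * c0) -> n * s1 = - (n * s0) ->
  c1 ^+ 2 + s1 ^+ 2 = 1 -> c0 ^+ 2 + s0 ^+ 2 = 1 ->
  (P * a1 + n * a0) ^+ 2 + (P * b1 + n * b0) ^+ 2 +
  ((P * (c1 * a1 + s1 * b1) + n * (c0 * a0 + s0 * b0)) ^+ 2 +
   (P * (c1 * b1 - s1 * a1) + n * (c0 * b0 - s0 * a0)) ^+ 2) =
  2 * P ^+ 2 * (a1 ^+ 2 + b1 ^+ 2) + 2 * n ^+ 2 * (a0 ^+ 2 + b0 ^+ 2).
Proof.
(* [X] and [Y] are the real and imaginary parts of [conj(z1) z0]; they carry the cross terms. *)
move=> e1 e2 q1 q0; pose X := a1 * a0 + b1 * b0; pose Y := a1 * b0 - b1 * a0.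
transitivity ((P * a1 + n * a0) ^+ 2 + (P * b1 + n * b0) ^+ 2 +
  (P ^+ 2 * (c1 ^+ 2 + s1 ^+ 2) * (a1 ^+ 2 + b1 ^+ 2) +
   n ^+ 2 * (c0 ^+ 2 + s0 ^+ 2) * (a0 ^+ 2 + b0 ^+ 2) +
   2 * P * (n * c1 * (c0 * X + s0 * Y) + n * s1 * (s0 * X - c0 * Y)))).
  by rewrite /X /Y; ring.
rewrite e1 e2 q1 q0.
rewrite (_ : - (n * c0) * _ + _ = - (n * (c0 ^+ 2 + s0 ^+ 2) * X)); last by ring.
by rewrite q0 /X; ring.
Qed.

(** * The bound on the number of functions *)

Section MeanDispersion.
Context {R : realType}.
Local Notation mu := (@lebesgue_measure R).
Implicit Types (f g : R -> R[i]) (u : R -> R).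

Lemma dot_mulX_hermfun u j : sqint mu u ->
  dot mu (fun x => x * u x) (hermfun j) =
  (4 * pi)^-1 * dot mu u (hermfun j.+1) + j%:R * dot mu u (hermfun j.-1).
Proof.
move=> su; rewrite -!dotZr//; [|exact: sqint_hermfun..].
rewrite -dotDr//; [|exact/sqintZ/sqint_hermfun..].
by apply: eq_Rintegral => x _; rewrite -[in RHS]mulX_hermfun; ring.
Qed.

Lemma weightE f j : dot mu (cre f) (hermfun j) ^+ 2 + dot mu (cim f) (hermfun j) ^+ 2 =
  weight f j * hermnorm j.
Proof. by rewrite /weight divfK// gt_eqF// hermnorm_gt0. Qed.

(* [|a + b|^2 + |a - b|^2 = 2 |a|^2 + 2 |b|^2], the second term coming from the
   Fourier transform, which multiplies the two neighbouring coefficients by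
   opposite powers of [- i]. *)
Lemma moment_coefficients f g j : is_fourier f g ->
  (dot mu (fun x => x * cre f x) (hermfun j) ^+ 2 +
   dot mu (fun x => x * cim f x) (hermfun j) ^+ 2) / hermnorm j +
  (dot mu (fun x => x * cre g x) (hermfun j) ^+ 2 +
   dot mu (fun x => x * cim g x) (hermfun j) ^+ 2) / hermnorm j =
  (2 * pi)^-1 * (j.+1%:R * weight f j.+1 + j%:R * weight f j.-1).
Proof.
move=> fg; have [/inLp2_sqint[fr fi] /inLp2_sqint[gr gi] _] := fg.
rewrite !dot_mulX_hermfun//.
have [-> ->] := fourier_hermite j.+1 fg; have [-> ->] := fourier_hermite j.-1 fg.
have cj0 : hermnorm j != 0 :> R by rewrite gt_eqF// hermnorm_gt0.
have P0 : 2 * pi != 0 :> R by rewrite mulf_neq0// gt_eqF// pi_gt0.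
have -> : (4 * pi)^-1 = 2^-1 * (2 * pi)^-1 :> R by rewrite -invfM; congr (_^-1); ring.
(* The norm recurrence multiplied by [j], so that it also holds at [j = 0], where [j.-1] is not a
   predecessor. *)
have Ej : j%:R * hermnorm j = 2 * (2 * pi) * j%:R ^+ 2 * hermnorm j.-1 :> R.
  by case: (j) => [|i]; [rewrite expr0n /= mul0r mulr0 mul0r|rewrite hermnormS/=; ring].
have [Eq1 Eq2] : j%:R * (@quarter R j.+1).1 = - (j%:R * (@quarter R j.-1).1) /\
    j%:R * (@quarter R j.+1).2 = - (j%:R * (@quarter R j.-1).2).
  by case: (j) => [|i] /=; [rewrite !mul0r oppr0|rewrite !mulrN].
rewrite -mulrDl (rotation_parallelogram _ _ _ _ _ Eq1 Eq2 (quarter_norm _) (quarter_norm _)).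
rewrite !weightE hermnormS; apply: (mulIf cj0); rewrite divfK//.
rewrite (_ : (2 * pi)^-1 * _ * _ = (2 * pi)^-1 * (j.+1%:R * weight f j.+1) * hermnorm j +
   (2 * pi)^-1 * (j%:R * hermnorm j) * weight f j.-1); last by ring.
rewrite Ej (_ : 4 * pi = 2 * (2 * pi)); last by ring.
by move: (2 * pi) P0 => t t0; field.
Qed.

(** [moment_coefficients] turns the shifted sum into Hermite coefficients of [x f] and [x g], to
    which Bessel applies. *)
Lemma weighted_sum_le_moments f g J (a b : R) : is_fourier f g ->
  [/\ sqint mu (fun x => x * cre f x), sqint mu (fun x => x * cim f x) &
    dot mu (fun x => x * cre f x) (fun x => x * cre f x) +
    dot mu (fun x => x * cim f x) (fun x => x * cim f x) <= a] ->
  [/\ sqint mu (fun x => x * cre g x), sqint mu (fun x => x * cim g x) &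
    dot mu (fun x => x * cre g x) (fun x => x * cre g x) +
    dot mu (fun x => x * cim g x) (fun x => x * cim g x) <= b] ->
  \sum_(j < J) (2 * j%:R + 1) * weight f j <= 2 * pi * (a + b).
Proof.
move=> fg [fr fi fa] [gr gi gb].
have p0 : 0 < 2 * pi :> R by rewrite mulr_gt0 ?pi_gt0.
apply: le_trans (sum_odd_shift J (weight_ge0 f)) _.
rewrite -ler_pdivrMl// mulr_sumr.
rewrite (eq_bigr _ (fun (j : 'I_J.+1) _ => esym (moment_coefficients j fg))).
rewrite big_split/=; apply: lerD.
- apply: le_trans fa; under eq_bigr do rewrite mulrDl; rewrite big_split/=.
  by apply: lerD; exact: hermite_bessel.
- apply: le_trans gb; under eq_bigr do rewrite mulrDl; rewrite big_split/=.
  by apply: lerD; exact: hermite_bessel.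
Qed.

Lemma mean_dispersion_bound (C : R) n (e ehat : nat -> R -> R[i]) : 0 <= C ->
  (forall j k, (j < n)%N -> (k < n)%N -> L2inner (e j) (e k) = (j == k)%:R) ->
  (forall k, (k < n)%N -> is_fourier (e k) (ehat k)) ->
  (forall k, (k < n)%N -> (dispersion (e k) <= C%:E)%E) ->
  (forall k, (k < n)%N -> (dispersion (ehat k) <= C%:E)%E) ->
  (forall k, (k < n)%N -> `|mean (e k)| <= C) ->
  (forall k, (k < n)%N -> `|mean (ehat k)| <= C) ->
  n%:R <= 8 * pi * C ^+ 2.
Proof.
move=> C0 oe ft dC dhC mC mhC.
have se k : (k < n)%N -> sqint mu (cre (e k)) /\ sqint mu (cim (e k)).
  by move=> /ft[/inLp2_sqint].
have she k : (k < n)%N -> sqint mu (cre (ehat k)) /\ sqint mu (cim (ehat k)).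
  by move=> /ft[_ /inLp2_sqint].
have N1 k : (k < n)%N -> dot mu (cre (e k)) (cre (e k)) + dot mu (cim (e k)) (cim (e k)) = 1.
  move=> kn; have [sr si] := se k kn.
  by have := oe k k kn kn; rewrite L2inner_dot// eqxx => -[].
pose W j := \sum_(k < n) weight (e k) j.
have W0 j : 0 <= W j by apply: sumr_ge0 => k _; exact: weight_ge0.
(* Bessel with the roles exchanged: the real function [hermfun j] is expanded along the family
   [e]. *)
have W1 j : W j <= 1.
  rewrite /W -mulr_suml ler_pdivrMr ?hermnorm_gt0// mul1r.
  exact: complex_bessel se oe (sqint_hermfun j).
have upper J : \sum_(j < J) (2 * j%:R + 1) * W j <= 8 * pi * C ^+ 2 * n%:R.
  under eq_bigr do rewrite mulr_sumr; rewrite exchange_big/=.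
  (* Each index contributes [2 pi (2 C^2 + 2 C^2)], one [2 C^2] from time and one from frequency. *)
  apply: (@le_trans _ _ (\sum_(k < n) 2 * pi * (2 * C ^+ 2 + 2 * C ^+ 2))).
    apply: ler_sum => k _; have kn := ltn_ord k.
    have [sr si] := se k kn; have [shr shi] := she k kn.
    apply: (weighted_sum_le_moments _ (ft k kn)).
    - exact: second_moment_le (N1 k kn) (dC k kn) (mC k kn).
    - apply: second_moment_le (dhC k kn) (mhC k kn) => //.
      by rewrite (plancherel (ft k kn)) N1.
  by rewrite sumr_const card_ord -[X in X <= _]mulr_natr; lra.
have limW : \sum_(j < J) W j @[J --> \oo] --> (n%:R : R).
  have E J : \sum_(j < J) W j = \sum_(k < n) \sum_(j < J) weight (e k) j.
    by rewrite exchange_big.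
  rewrite (funext E) (_ : n%:R = \sum_(k < n) (1 : R)); last by rewrite sumr_const card_ord.
  apply: cvg_big => //=; first by move=> ?; exact: add_continuous.
  move=> k _; have [sr si] := se k (ltn_ord k).
  by rewrite -(N1 k (ltn_ord k)); exact: weight_parseval.
(* As [J] grows the total weight tends to [n], and the lower bound becomes [n^2]. *)
have bound : 2 * n%:R * n%:R - n%:R ^+ 2 <= 8 * pi * C ^+ 2 * n%:R :> R.
  have L : 2 * n%:R * (\sum_(j < J) W j) - n%:R ^+ 2 @[J --> \oo] -->
      (2 * n%:R * n%:R - n%:R ^+ 2 : R).
    by apply: cvgB; [exact: cvgMr|exact: cvg_cst].
  apply: (cvgr_to_le L); apply: nearW => J.
  exact: le_trans (sum_odd_lower n J W0 W1) (upper J).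
(* Dividing by [n] requires [n > 0]. *)
case: n bound {oe ft dC dhC mC mhC se she N1 W W0 W1 upper limW} => [_|n].
  by rewrite !mulr_ge0 ?pi_ge0 ?sqr_ge0.
rewrite (_ : _ - _ = n.+1%:R * n.+1%:R); last by ring.
by rewrite ler_pM2r.
Qed.

End MeanDispersion.

Theorem mainTheorem2 (R : realType) (C : R) (N : option nat)
    (e ehat : nat -> R -> R[i])
    (hC : 0 <= C)
    (he : orthonormal_seq N e)
    (hehat : forall k, indices N k -> is_fourier (e k) (ehat k))
    (hdisp : forall k, indices N k -> (dispersion (e k) <= C%:E)%E)
    (hdisphat : forall k, indices N k -> (dispersion (ehat k) <= C%:E)%E)
    (hmean : forall k, indices N k -> `|mean (e k)| <= C)
    (hmeanhat : forall k, indices N k -> `|mean (ehat k)| <= C) :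
  exists2 n : nat, N = Some n & n%:R <= 8 * pi * C ^+ 2.
Proof.
case: he => _ oe.
have bound n : (forall k, (k < n)%N -> indices N k) -> n%:R <= 8 * pi * C ^+ 2.
  move=> nN; apply: (@mean_dispersion_bound R C n e ehat) => // [j k|k|k|k|k|k].
  - by move=> /nN jN /nN kN; exact: oe.
  - by move=> /nN; exact: hehat.
  - by move=> /nN; exact: hdisp.
  - by move=> /nN; exact: hdisphat.
  - by move=> /nN; exact: hmean.
  - by move=> /nN; exact: hmeanhat.
case: N oe hehat hdisp hdisphat hmean hmeanhat bound => [n|] _ _ _ _ _ _ bound.
  by exists n => //; exact: bound.
have B0 : 0 <= 8 * pi * C ^+ 2 by rewrite !mulr_ge0 ?pi_ge0 ?sqr_ge0.
(* An infinite sequence would have an initial segment longer than [8 pi C^2]. *)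
have := bound (Num.truncn (8 * pi * C ^+ 2)).+1 (fun _ _ => I).
by rewrite leNgt truncnS_gt.
Qed.
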